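(* Let $\epsilon>0$ and let $a=(a_i)_{i=1}^\infty$ be a non-increasing sequence with $a_i\in(0,1)$ for every $i$. If the dyadic slit carpet $\mathbb{M}^a$ admits a bi-Lipschitz embedding into the Hilbert space $\ell_2$, then $a\in\ell_{1+\epsilon}$, i.e. $\sum_i a_i^{1+\epsilon}<\infty$.
   Context: A map $f:(X,d_X)\to(Y,d_Y)$ is a bi-Lipschitz embedding if there are constants $0<c\le C$ with $c\,d_X(x,y)\le d_Y(f(x),f(y))\le C\,d_X(x,y)$ for all $x,y\in X$. $\ell_2$ is the separable infinite-dimensional Hilbert space. Construction of $\mathbb{M}^a$: for each $n\ge1$ and each dyadic square $Q=[l2^{-n},(l+1)2^{-n}]\times[k2^{-n},(k+1)2^{-n}]\subset[0,1]^2$ ($0\le l,k\le 2^n-1$), remove from $[0,1]^2$ the closed vertical segment (slit) of length $a_n2^{-n-1}$ whose midpoint is the center of $Q$. Equip the set remaining after all these removals with its path metric (infimum of Euclidean lengths of paths in the remaining set), and let $\mathbb{M}^a$ be the metric completion. *)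

(* Defs.v *)
From HB Require Import structures.
From mathcomp Require Import all_boot all_order all_algebra.
From mathcomp Require Import all_classical all_reals all_analysis.
Set Implicit Arguments.
Unset Strict Implicit.
Unset Printing Implicit Defensive.
Import Order.TTheory GRing.Theory Num.Theory.
Import numFieldNormedType.Exports.
Local Open Scope classical_set_scope.
Local Open Scope ring_scope.

(* Metric spaces are given below by a carrier and a distance function, because
   the path distance of the slit domain is a genuine metric only under the
   hypotheses made on the slit lengths. *)

Definition bilipschitz_embedding (R : realType) (X Y : Type)
    (dX : X -> X -> R) (dY : Y -> Y -> R) (f : X -> Y) : Prop :=
  exists c C : R, [/\ 0 < c, c <= C &
    forall x y, c * dX x y <= dY (f x) (f y) <= C * dX x y].

(* The counting measure on nat has no nonempty null set, so the functions of
   finite L2-norm need not be quotiented by almost-everywhere equality. *)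
Definition ell2 (R : realType) : Type :=
  LfunType (@counting nat R : {measure set nat -> \bar R}) (lee1n 2).

Definition ell2_dist (R : realType) (u v : ell2 R) : R :=
  fine ('N[counting]_2%:E [EFin \o (fun i => (u i - v i)%R)])%E.

Section metric_completion.
Context {R : realType} {T : Type} (d : T -> T -> R).

Definition cauchy_sequence (u : nat -> T) : Prop :=
  forall e : R, 0 < e ->
    exists N, forall m n, (N <= m)%N -> (N <= n)%N -> d (u m) (u n) < e.

Definition cauchy_class (u : nat -> T) : set (nat -> T) :=
  [set v | cauchy_sequence v /\ d (u n) (v n) @[n --> \oo] --> (0 : R)].

(* Cauchy sequences modulo "the distance between the terms tends to 0". *)
Definition metric_completion : Type :=
  {A : set (nat -> T) | exists2 u, cauchy_sequence u & A = cauchy_class u}.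

Definition completion_repr (A : metric_completion) : nat -> T :=
  s2val (cid2 (proj2_sig A)).

Definition completion_dist (A B : metric_completion) : R :=
  limn (fun n => d (completion_repr A n) (completion_repr B n)).

End metric_completion.

Arguments completion_dist {R T} d A B.

Section path_metric.
Context {R : realType}.

(* The library norm on R * R is the sup norm. *)
Definition euclidean_dist (p q : R * R) : R :=
  Num.sqrt ((p.1 - q.1) ^+ 2 + (p.2 - q.2) ^+ 2).

(* Same shape as [variation], for a curve in the plane. *)
Definition polygonal_length (g : R -> R * R) (s : seq R) : R :=
  let F := g \o nth 1 (0 :: s) in
  \sum_(0 <= n < size s) euclidean_dist (F n) (F n.+1).

Definition curve_length (g : R -> R * R) : \bar R :=
  ereal_sup [set (polygonal_length g s)%:E | s in itv_partition 0 1].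

Definition path_in (S : set (R * R)) (p q : R * R) : set (R -> R * R) :=
  [set g : R -> R * R | [/\ {within `[0, 1], continuous g}, g 0 = p, g 1 = q &
               forall t, 0 <= t <= 1 -> S (g t)]].

Definition path_dist (S : set (R * R)) (p q : set_type S) : R :=
  fine (ereal_inf
    [set curve_length g | g in path_in S (set_val p) (set_val q)]).

End path_metric.

Section slit_carpet.
Context {R : realType}.

Definition unit_square : set (R * R) :=
  [set p | 0 <= p.1 <= 1 /\ 0 <= p.2 <= 1].

(* The slit of the square [l 2^-n, (l+1) 2^-n] x [k 2^-n, (k+1) 2^-n]:
   its half-length is a_n 2^-(n+1) / 2. *)
Definition dyadic_slit (a : nat -> R) (n l k : nat) : set (R * R) :=
  [set p | p.1 = (l%:R + 2^-1) / 2 ^+ n /\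
           `|p.2 - (k%:R + 2^-1) / 2 ^+ n| <= a n / 2 ^+ n.+1 / 2].

(* The scales are n = 1, 2, and so on; the value [a 0] is never used. *)
Definition slit_domain (a : nat -> R) : set (R * R) :=
  unit_square `\`
  [set p | exists n l k : nat,
    [/\ (0 < n)%N, (l < 2 ^ n)%N, (k < 2 ^ n)%N & dyadic_slit a n l k p]].

(* When 0 < a n < 1 for all n > 0, any two points of the slit domain are joined
   by a curve of finite length in it, so that [fine] in [path_dist] is harmless:
   vertical lines at irrational abscissae and the line at height 1/2 avoid all
   slits, and a point of dyadic abscissa reaches such a vertical line. *)
Definition slit_carpet (a : nat -> R) : Type :=
  metric_completion (@path_dist R (slit_domain a)).

Definition slit_carpet_dist (a : nat -> R) :
    slit_carpet a -> slit_carpet a -> R :=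
  completion_dist (@path_dist R (slit_domain a)).

End slit_carpet.

(* Main.v *)
Require Import Defs.
From HB Require Import structures.
From mathcomp Require Import all_boot all_order all_algebra.
From mathcomp Require Import all_classical all_reals all_analysis.
From mathcomp Require Import ring lra.
Set Implicit Arguments.
Unset Strict Implicit.
Unset Printing Implicit Defensive.
Import Order.TTheory GRing.Theory Num.Theory.
Import numFieldNormedType.Exports.
Local Open Scope classical_set_scope.
Local Open Scope ring_scope.

(** The vertical segments above non-dyadic abscissae avoid all slits. Let f be
    the embedding, with constants c and C. Around a slit of length l, a
    point above it, a point below it and the two sides of its midpoint
    form a quadrilateral with sides s and vertical diagonal 2 s, where s
    is comparable to l, and with horizontal diagonal at least l in the
    path metric; by the quadrilateral inequality of Hilbert space, f
    stretches one of the sides more than the vertical diagonal, by a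
    definite amount.

    Fix N and d = a_N: all slits of scale at most N have relative length
    at least d. Take a vertical segment of length L stretched by f with
    slope v, and move it horizontally, by at most w = 2^-m with w of order
    d L, next to the centres of the slits of scale m. The move changes the
    slope by O(w / L), and a fraction of order d of the moved segment runs
    along slits. Hence some vertical segment of length at least of order
    d^2 L has slope at least v + gamma d, where gamma > 0 depends on c and
    C only. This can be repeated as long as d L is at least of order 2^-N,
    that is about N / log(1/d) times, while slopes are bounded by C. So
    N a_N <= K log(1/a_N), whence a_N^(1+q) = O(1/N) for every q > 0, and
    the sum of the a_N^(1+eps) converges. *)

(** * Squared distances and the quadrilateral inequality in Hilbert space *)

Section ell2_geometry.
Context {R : realType}.
Implicit Types u v w z : ell2 R.

Lemma ell2_dist_fineK u v :
  (ell2_dist u v)%:E =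
  ('N[counting]_2%:E [EFin \o (fun i => (u i - v i)%R)])%E.
Proof. exact: (finite_norm_fine (u - v)). Qed.

Lemma ell2_dist_ge0 u v : 0 <= ell2_dist u v.
Proof. by rewrite -lee_fin ell2_dist_fineK Lnorm_ge0. Qed.

Lemma ell2_distC u v : ell2_dist u v = ell2_dist v u.
Proof.
rewrite /ell2_dist -oppe_Lnorm; congr fine; apply: eq_Lnorm => i /=.
by rewrite opprB.
Qed.

Lemma ell2_dist_triangle v u w :
  ell2_dist u w <= ell2_dist u v + ell2_dist v w.
Proof.
have := ler_LnormD (u - v) (v - w); congr (_ <= _).
by congr fine; apply: eq_Lnorm => i /=; rewrite addrA subrK.
Qed.

Lemma ell2_dist_sqr u v :
  ((ell2_dist u v) ^+ 2)%:E = (\int[counting]_i ((u i - v i) ^+ 2)%:E)%E.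
Proof.
have h0 : 0 <= ell2_dist u v := ell2_dist_ge0 u v.
rewrite -powR_mulrn// -poweR_EFin ell2_dist_fineK poweR_Lnorm ?pnatr_eq0//.
by apply: eq_integral => i _; rewrite /= powR_mulrn ?real_normK ?num_real.
Qed.

(** The right side minus the left side is the squared norm of [u - v + w - z]; the identity is
    checked coordinatewise under the sum. *)
Lemma ell2_quadrilateral u v w z :
  ell2_dist u w ^+ 2 + ell2_dist v z ^+ 2 <=
  ell2_dist u v ^+ 2 + ell2_dist v w ^+ 2 + ell2_dist w z ^+ 2 +
  ell2_dist z u ^+ 2.
Proof.
rewrite -lee_fin !EFinD !ell2_dist_sqr.
have p (f g : nat -> R) i : (0 <= ((f i - g i) ^+ 2)%:E)%E.
  by rewrite lee_fin sqr_ge0.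
rewrite -!ge0_integralD//; try by move=> i _; rewrite ?adde_ge0// ?adde_ge0.
apply: ge0_le_integral => // i _; rewrite ?adde_ge0 ?adde_ge0//.
rewrite -!EFinD lee_fin -subr_ge0.
by rewrite (_ : _ - _ = (u i - v i + w i - z i) ^+ 2) ?sqr_ge0//; ring.
Qed.

End ell2_geometry.

(** * Euclidean distance in the plane *)

Section euclidean_plane.
Context {R : realType}.
Implicit Types p q r : R * R.

Lemma euclidean_dist_ge0 p q : 0 <= euclidean_dist p q.
Proof. exact: sqrtr_ge0. Qed.

Lemma euclidean_distxx p : euclidean_dist p p = 0.
Proof. by rewrite /euclidean_dist !subrr expr0n addr0 sqrtr0. Qed.

Lemma euclidean_norm_triangle (a b c d : R) :
  Num.sqrt ((a + c) ^+ 2 + (b + d) ^+ 2) <=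
  Num.sqrt (a ^+ 2 + b ^+ 2) + Num.sqrt (c ^+ 2 + d ^+ 2).
Proof.
have u0 := sqrtr_ge0 (a ^+ 2 + b ^+ 2).
have v0 := sqrtr_ge0 (c ^+ 2 + d ^+ 2).
rewrite -ler_sqr ?nnegrE ?addr_ge0 ?sqrtr_ge0//.
rewrite sqr_sqrtr ?addr_ge0 ?sqr_ge0// [leRHS]sqrrD.
rewrite !sqr_sqrtr ?addr_ge0 ?sqr_ge0//.
have : a * c + b * d <= Num.sqrt (a ^+ 2 + b ^+ 2) * Num.sqrt (c ^+ 2 + d ^+ 2).
  rewrite -sqrtrM ?addr_ge0 ?sqr_ge0//.
  rewrite (le_trans (ler_norm _))// -sqrtr_sqr ler_wsqrtr//.
  (* Lagrange's identity, which gives the Cauchy-Schwarz inequality. *)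
  rewrite -subr_ge0 (_ : _ - _ = (a * d - b * c) ^+ 2) ?sqr_ge0//.
  ring.
lra.
Qed.

Lemma ler_euclidean_dist2 p q : `|p.2 - q.2| <= euclidean_dist p q.
Proof. by rewrite -sqrtr_sqr ler_wsqrtr// lerDr sqr_ge0. Qed.

Lemma euclidean_dist_horizontal (x x' y : R) :
  euclidean_dist (x, y) (x', y) = `|x - x'|.
Proof. by rewrite /euclidean_dist/= subrr expr0n addr0 sqrtr_sqr. Qed.

Lemma euclidean_dist_vertical (x y y' : R) :
  euclidean_dist (x, y) (x, y') = `|y - y'|.
Proof. by rewrite /euclidean_dist/= subrr expr0n add0r sqrtr_sqr. Qed.

End euclidean_plane.

(** * Length of curves and of their concatenations *)

Section curve_length.
Context {R : realType}.
Implicit Types (g : R -> R * R) (s : seq R).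

(** A recursive form of [polygonal_length], with a free starting time for inductions on the
    partition. *)
Fixpoint chain_length g (x : R) s : R :=
  if s is y :: s' then euclidean_dist (g x) (g y) + chain_length g y s' else 0.

Lemma polygonal_lengthE g s : polygonal_length g s = chain_length g 0 s.
Proof.
rewrite /polygonal_length.
suff gen (x : R) : \sum_(0 <= n < size s) euclidean_dist
    (g (nth 1 (x :: s) n)) (g (nth 1 (x :: s) n.+1)) = chain_length g x s.
  exact: gen.
elim: s x => [|y s IHs] x; first by rewrite big_geq.
by rewrite big_nat_recl//= -IHs.
Qed.

Lemma chain_length_map g (c : R -> R) x s :
  chain_length (g \o c) x s = chain_length g (c x) (map c s).
Proof. by elim: s x => //= y s IHs x; rewrite IHs. Qed.

(** Partitions are strictly increasing, but repeated times add length zero and can be deleted.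
    Clamped reparametrisations produce such repetitions. *)
Lemma chain_length_le_curve_length g s :
  path <=%R 0 s -> last 0 s = 1 ->
  ((chain_length g 0 s)%:E <= curve_length g)%E.
Proof.
move=> s01 ls.
have [s' [s'lt s'l ->]] : exists s', [/\ path <%R 0 s', last 0 s' = 1 &
    chain_length g 0 s = chain_length g 0 s'].
  rewrite -ls; move: s01 {ls}; move: 0 => x.
  elim: s x => [|y s IHs] x /=; first by exists [::].
  move=> /andP[xy /IHs[s' [s'lt s'l s'g]]].
  move: xy; rewrite le_eqVlt => /predU1P[->|xy].
    by exists s'; rewrite euclidean_distxx add0r.
  by exists (y :: s'); rewrite /= xy s'g.
rewrite -polygonal_lengthE; apply: ereal_sup_ubound; exists s' => //.
by split => //; exact/eqP.
Qed.

Lemma curve_length_ge0 g : (0 <= curve_length g)%E.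
Proof.
apply: le_trans (@chain_length_le_curve_length g [:: 1] _ _) => //=.
  by rewrite addr0 lee_fin euclidean_dist_ge0.
by rewrite ler01.
Qed.

Lemma curve_length_lipschitz g (K : R) :
  (forall t u : R, euclidean_dist (g t) (g u) <= K * `|t - u|) ->
  (curve_length g <= K%:E)%E.
Proof.
move=> gK; apply: ge_ereal_sup => _ [s [slt /eqP sl] <-].
rewrite lee_fin polygonal_lengthE.
rewrite -[K]mulr1 -[1]subr0 -sl; move: 0 slt {sl} => x.
elim: s x => [|y s IHs] x /=; first by rewrite subrr mulr0.
move=> /andP[xy /IHs]; have := gK x y.
rewrite distrC gtr0_norm ?subr_gt0//; lra.
Qed.

(* The sum form makes continuity immediate and lets the length of the
   concatenation be estimated without splitting partitions at 1/2. *)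
Definition concat_curves g1 g2 : R -> R * R := fun t =>
  g1 (Num.min (2 * t) 1) + g2 (Num.max (2 * t - 1) 0) - g2 0.

(** Both clamped time changes are monotone and map a partition of [0, 1] to a weak one; each
    increment of the concatenation is the sum of the increments of the two pieces. *)
Lemma concat_curves_length g1 g2 :
  (curve_length (concat_curves g1 g2) <= curve_length g1 + curve_length g2)%E.
Proof.
apply: ge_ereal_sup => _ [s [slt /eqP sl] <-].
rewrite polygonal_lengthE.
pose c1 (t : R) := Num.min (2 * t) 1; pose c2 (t : R) := Num.max (2 * t - 1) 0.
have c1m : {homo c1 : x y / x <= y}.
  by move=> x y xy; rewrite /c1 le_min !ge_min lexx ler_pM2l// xy orbT.
have c2m : {homo c2 : x y / x <= y}.
  by move=> x y xy; rewrite /c2 ge_max !le_max lexx lerB ?ler_pM2l// orbT.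
have sle : path <=%R 0 s by apply: sub_path slt => x y /ltW.
have len (c : R -> R) g : {homo c : x y / x <= y} -> c 0 = 0 -> c 1 = 1 ->
    ((chain_length (g \o c) 0 s)%:E <= curve_length g)%E.
  move=> cm c0 c1E; rewrite chain_length_map c0.
  apply: chain_length_le_curve_length; rewrite -c0 ?last_map ?sl ?c0 //.
  by rewrite -{1}c0; apply: homo_path sle.
apply: (@le_trans _ _ (chain_length (g1 \o c1) 0 s +
                       chain_length (g2 \o c2) 0 s)%:E); last first.
  rewrite EFinD leeD// len// /c1 /c2.
  - by rewrite mulr0 min_l// ler01.
  - by rewrite mulr1 min_r// ler1n.
  - by rewrite mulr0 sub0r max_r// lerN10.
  - by rewrite mulr1 [2]mulr2n addrK max_l// ler01.
rewrite lee_fin; move: 0 => x; elim: s x {sle len slt sl} => [|y s IHs] x /=.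
  by rewrite addr0.
rewrite addrACA lerD//.
rewrite /concat_curves -/(c1 _) -/(c2 _) -/(c1 _) -/(c2 _).
apply: le_trans (euclidean_norm_triangle _ _ _ _).
rewrite /euclidean_dist/= ler_wsqrtr// le_eqVlt; apply/orP; left; apply/eqP.
by congr (_ ^+ 2 + _ ^+ 2); ring.
Qed.

End curve_length.

(** * Path metric of a plane set, with values in the extended reals *)

Section path_metric_theory.
Context {R : realType}.
Variable S : set (R * R).
Implicit Types p q r : R * R.

(** The value of [path_dist] before [fine]: the triangle inequality holds for it even between points
    that no rectifiable path joins. *)
Definition path_inf p q : \bar R :=
  ereal_inf [set curve_length g | g in path_in S p q].

Lemma path_inf_ge0 p q : (0 <= path_inf p q)%E.
Proof. by apply: le_ereal_inf_tmp => _ [g _ <-]; exact: curve_length_ge0. Qed.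

Lemma within_continuous_reparam (g : R -> R * R) (c : R -> R) :
  {within `[0, 1], continuous g} -> continuous c ->
  (forall t, 0 <= t <= 1 -> 0 <= c t <= 1) ->
  {within `[0, 1], continuous (g \o c)}.
Proof.
move=> /subspace_continuousP gc cc c01; apply/subspace_continuousP => t t01.
have ct01 : `[0, 1]%classic (c t) by move: t01; rewrite /= !in_itv; exact: c01.
apply: cvg_comp (gc _ ct01) => P; move=> /(cc t).
apply: (@filterS _ (nbhs t)) => u Pu u01; apply: Pu.
by move: u01; rewrite /= !in_itv/=; exact: c01.
Qed.

Lemma path_in_concat p q r g1 g2 :
  path_in S p q g1 -> path_in S q r g2 -> path_in S p r (concat_curves g1 g2).
Proof.
move=> [g1c g10 g11 g1S] [g2c g20 g21 g2S].
have c1E (t : R) : 0 <= t <= 1 -> 0 <= Num.min (2 * t) 1 <= 1.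
  move=> /andP[t0 t1]; rewrite ge_min lexx orbT andbT le_min ler01 andbT.
  by rewrite mulr_ge0.
have c2E (t : R) : 0 <= t <= 1 -> 0 <= Num.max (2 * t - 1) 0 <= 1.
  move=> /andP[t0 t1]; rewrite le_max lexx orbT /= ge_max ler01 andbT; lra.
split.
- have h1 : {within `[0, 1], continuous (g1 \o fun t : R => Num.min (2 * t) 1)}.
    apply: within_continuous_reparam c1E => // t.
    apply: (@continuous_min R _ (fun t : R => 2 * t) (cst 1));
      last exact: cst_continuous.
    by apply: continuousM; [exact: cst_continuous|exact: cvg_id].
  have h2 : {within `[0, 1],
      continuous (g2 \o fun t : R => Num.max (2 * t - 1) 0)}.
    apply: within_continuous_reparam c2E => // t.
    apply: (@continuous_max R _ (fun t : R => 2 * t - 1) (cst 0));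
      last exact: cst_continuous.
    apply: continuousB; last exact: cst_continuous.
    by apply: continuousM; [exact: cst_continuous|exact: cvg_id].
  have hD t := @continuousD R _ _ _ _ t (h1 t) (h2 t).
  exact: (fun t =>
    @continuousB R _ _ _ _ t (hD t) (@cst_continuous _ _ (g2 0) t)).
- by rewrite /concat_curves mulr0 min_l ?ler01// sub0r max_r ?lerN10// addrK.
- rewrite /concat_curves mulr1 min_r ?ler1n//.
  rewrite (_ : 2 - 1 = 1 :> R); last by lra.
  by rewrite max_l ?ler01// g11 g20 g21 addrAC subrr add0r.
- move=> t t01; rewrite /concat_curves.
  have [th|th] := leP t 2^-1.
    rewrite min_l ?max_r ?addrK; [|lra|lra].
    by apply: g1S; move: t01 => /andP[t0 t1]; apply/andP; split; lra.
  rewrite min_r ?max_l; [|lra|lra].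
  rewrite g11 g20 addrAC subrr add0r.
  by apply: g2S; move: t01 => /andP[t0 t1]; apply/andP; split; lra.
Qed.

Lemma path_inf_triangle q p r :
  (path_inf p r <= path_inf p q + path_inf q r)%E.
Proof.
have n u v : path_inf u v != -oo%E.
  by rewrite -ltNye (lt_le_trans _ (path_inf_ge0 _ _)).
have [->|pq] := eqVneq (path_inf p q) +oo%E; first by rewrite addye ?leey.
have [->|qr] := eqVneq (path_inf q r) +oo%E; first by rewrite addey ?leey.
have pqf : path_inf p q \is a fin_num by rewrite fin_numE n pq.
have qrf : path_inf q r \is a fin_num by rewrite fin_numE n qr.
apply/lee_addgt0Pr => e e0; have e20 : 0 < e / 2 by rewrite divr_gt0.
have [_ [g1 g1P <-] g1l] := lb_ereal_inf_adherent e20 pqf.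
have [_ [g2 g2P <-] g2l] := lb_ereal_inf_adherent e20 qrf.
apply: (@le_trans _ _ (curve_length g1 + curve_length g2)%E).
  apply: le_trans (concat_curves_length _ _); apply: ereal_inf_lbound.
  by exists (concat_curves g1 g2) => //; exact: path_in_concat g1P g2P.
apply: le_trans (leeD (ltW g1l) (ltW g2l)) _.
by rewrite addeACA -EFinD -splitr.
Qed.

Definition segment p q (t : R) : R * R :=
  (p.1 + t * (q.1 - p.1), p.2 + t * (q.2 - p.2)).

Lemma path_inf_segment p q :
  (forall t, 0 <= t <= 1 -> S (segment p q t)) ->
  (path_inf p q <= (euclidean_dist p q)%:E)%E.
Proof.
move=> pqS; apply: (@le_trans _ _ (curve_length (segment p q))).
  apply: ereal_inf_lbound; exists (segment p q) => //; split => //.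
  - apply: continuous_subspaceT => t.
    have affine (u v : R) : u + s * v @[s --> t] --> u + t * v.
      by apply: cvgD; [exact: cvg_cst|apply: cvgMr_tmp; exact: cvg_id].
    exact: (cvg_pair (affine _ _) (affine _ _)).
  - by rewrite /segment !mul0r !addr0; case: (p).
  - by rewrite /segment !mul1r !subrKC; case: (q).
apply: curve_length_lipschitz => t u; rewrite /euclidean_dist/=.
rewrite -sqrtr_sqr -sqrtrM ?addr_ge0 ?sqr_ge0// ler_wsqrtr//.
by rewrite le_eqVlt; apply/orP; left; apply/eqP; ring.
Qed.

(* A path from p to q meets the line of abscissa x0 at distance at least h from
   both p and q. *)
Lemma path_inf_cross (x0 h : R) p q :
  p.1 < x0 < q.1 -> p.2 = q.2 ->
  (forall y, S (x0, y) -> h <= `|y - p.2|) ->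
  ((2 * h)%:E <= path_inf p q)%E.
Proof.
move=> /andP[px qx] pq2 xS; apply: le_ereal_inf_tmp => _ [g [gc g0 g1 gS] <-].
have [] := @IVT _ (fun t => (g t).1) 0 1 x0 ler01.
- move=> t; apply: (@cvg_comp _ _ _ g fst); first exact: gc.
  exact: cvg_fst.
- by rewrite g0 g1 ge_min (ltW px) le_max (ltW qx) orbT.
move=> t; rewrite in_itv/= => /andP[t0 t1] gtx.
have ht : h <= `|(g t).2 - p.2|.
  by apply: xS; rewrite -gtx -surjective_pairing; apply: gS; rewrite t0.
apply: le_trans (@chain_length_le_curve_length _ g [:: t; 1] _ _) => //=.
  rewrite lee_fin addr0 g0 g1.
  have := ler_euclidean_dist2 p (g t); rewrite distrC.
  by have := ler_euclidean_dist2 (g t) q; rewrite -pq2; lra.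
by rewrite t0 t1.
Qed.

End path_metric_theory.

(** * Isometric inclusion of a space into its completion *)

Section completion_embedding.
Context {R : realType} {T : Type} (d : T -> T -> R).
Hypothesis dxx : forall x, d x x = 0.
Hypothesis d_triangle : forall y x z, d x z <= d x y + d y z.

Lemma cauchy_sequence_cst (x : T) : cauchy_sequence d (fun=> x).
Proof. by move=> e e0; exists 0%N => m n _ _; rewrite dxx. Qed.

Definition completion_incl (x : T) : metric_completion d :=
  exist _ (cauchy_class d (fun=> x))
    (ex_intro2 _ _ (fun=> x) (cauchy_sequence_cst x) erefl).

(* The representative chosen for the class of [x] is an arbitrary Cauchy sequence
   converging to [x]; both one-sided limits hold, so symmetry is not needed. *)
Lemma completion_repr_incl (x : T) :
  d x (completion_repr (completion_incl x) n) @[n --> \oo] --> (0 : R) /\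
  d (completion_repr (completion_incl x) n) x @[n --> \oo] --> (0 : R).
Proof.
rewrite /completion_repr; case: cid2 => u uc /= xu; split.
  have : cauchy_class d u u.
    by split => //; under eq_fun do rewrite dxx; exact: cvg_cst.
  by rewrite -xu => -[].
have : cauchy_class d (fun=> x) (fun=> x).
  split; first exact: cauchy_sequence_cst.
  by under eq_fun do rewrite dxx; exact: cvg_cst.
by rewrite xu => -[].
Qed.

Lemma completion_dist_incl (x y : T) :
  completion_dist d (completion_incl x) (completion_incl y) = d x y.
Proof.
have [xu ux] := completion_repr_incl x; have [yv vy] := completion_repr_incl y.
rewrite /completion_dist.
set u := completion_repr (completion_incl x) in xu ux *.
set v := completion_repr (completion_incl y) in yv vy *.
apply: cvg_lim => //.
apply: (@squeeze_cvgr _ _ _ _ (fun n => d x y - (d x (u n) + d (v n) y))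
  (fun n => d x y + (d (u n) x + d y (v n)))).
- apply: nearW => n; apply/andP; split.
    have := d_triangle (u n) x y; have := d_triangle (v n) (u n) y; lra.
  have := d_triangle x (u n) (v n); have := d_triangle y x (v n); lra.
- rewrite -[X in _ --> X]subr0; apply: cvgB; first exact: cvg_cst.
  by rewrite -(addr0 0); exact: cvgD.
- rewrite -[X in _ --> X]addr0; apply: cvgD; first exact: cvg_cst.
  by rewrite -(addr0 0); exact: cvgD.
Qed.

End completion_embedding.

(** * Dyadic and nondyadic abscissae *)

Section dyadic_numbers.
Context {R : realType}.

Lemma exp2_gt0 n : 0 < 2 ^+ n :> R.
Proof. by rewrite exprn_gt0. Qed.

Lemma half_gap (j k : nat) : 2^-1 <= `|j%:R - (k%:R + 2^-1)| :> R.
Proof.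
have [jk|kj] := leqP j k.
  have : j%:R <= k%:R :> R by rewrite ler_nat.
  by move=> jkR; rewrite ler0_norm; lra.
have : k.+1%:R <= j%:R :> R by rewrite ler_nat.
by rewrite -natr1 => kjR; rewrite ger0_norm; lra.
Qed.

(** After clearing denominators, different scales would equate an odd and an even number. Hence a
    vertical line through a slit meets slits of one scale only. *)
Lemma dyadic_midpoint_inj (m i n l : nat) :
  (l%:R + 2^-1) / 2 ^+ n = (i%:R + 2^-1) / 2 ^+ m :> R -> n = m.
Proof.
wlog nm : m i n l / (n <= m)%N.
  move=> H E; have [nm|/ltnW mn] := leqP n m; first exact: H nm E.
  by rewrite (H _ _ _ _ mn (esym E)).
move: nm; rewrite leq_eqVlt => /predU1P[//|/subnKC <-].
move=> E; set j := (m - n.+1)%N in E.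
have n0 := exp2_gt0 n; have j0 := exp2_gt0 j.
have : ((2 * l + 1) * 2 ^ j * 2)%:R = (2 * i + 1)%:R :> R.
  transitivity ((l%:R + 2^-1) / 2 ^+ n * (2 * 2 ^+ n * 2 ^+ j * 2) : R).
    by rewrite !natrM natrD natrM natrX; field; rewrite lt0r_neq0.
  rewrite E exprD exprS natrD natrM; field; rewrite !lt0r_neq0//.
move=> /eqP; rewrite eqr_nat => /eqP/(congr1 odd).
by rewrite !(oddM, oddD) /= andbF.
Qed.

Definition nondyadic (x : R) : Prop :=
  0 < x < 1 /\ forall n l : nat, x * 2 ^+ n <> l%:R.

Lemma nondyadic_neq_midpoint x n l : nondyadic x -> x <> (l%:R + 2^-1) / 2 ^+ n.
Proof.
move=> [_ xnd] xE; apply: (xnd n.+1 (2 * l + 1)%N).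
rewrite xE exprS natrD natrM; field; exact/lt0r_neq0/exp2_gt0.
Qed.

Lemma nondyadic_strip x m : nondyadic x ->
  exists2 i : nat, (i < 2 ^ m)%N & i%:R / 2 ^+ m < x < i.+1%:R / 2 ^+ m.
Proof.
move=> [/andP[x0 x1] xnd]; have m0 := exp2_gt0 m.
have xm0 : 0 <= x * 2 ^+ m by rewrite mulr_ge0 // ltW.
have /andP[tl tr] := Num.Theory.truncn_itv xm0.
set i := Num.truncn (x * 2 ^+ m) in tl tr.
have {}tl : i%:R < x * 2 ^+ m.
  by rewrite lt_neqAle tl andbT eq_sym; apply/eqP.
exists i; last by rewrite ltr_pdivrMr// ltr_pdivlMr// tl tr.
by rewrite -(ltr_nat R) natrX (lt_trans tl)// gtr_pMl//.
Qed.

(* Clearing denominators in [(2 i + 1) / 2^m +- 1 / (3 * 2^M) = l / 2^n]. *)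
Lemma thirds_not_dyadic (i n m M l : nat) :
  ((2 * i + 1) * 3 * 2 ^ M * 2 ^ n + 2 ^ m * 2 ^ n <>
   l * 3 * 2 ^ M * 2 ^ m)%N /\
  ((2 * i + 1) * 3 * 2 ^ M * 2 ^ n <>
   l * 3 * 2 ^ M * 2 ^ m + 2 ^ m * 2 ^ n)%N.
Proof.
have n3 : ~~ (3 %| 2 ^ m * 2 ^ n)%N by rewrite -expnD Euclid_dvdX.
have d3 u v : (3 %| u * 3 * 2 ^ M * v)%N by rewrite -!mulnA mulnCA dvdn_mulr.
split=> /(congr1 (dvdn 3)).
  by rewrite dvdn_addr ?d3//= (negbTE n3).
by rewrite [in RHS]dvdn_addr ?d3//= (negbTE n3).
Qed.

(** The factor 3 in the denominator of the offset survives in the sum. This gives nondyadic lines on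
    both sides of a slit, as close to it as desired. *)
Lemma nondyadic_near_midpoint (m i M : nat) : (i < 2 ^ m)%N -> (m < M)%N ->
  let x0 : R := (i%:R + 2^-1) / 2 ^+ m in let t : R := (3 * 2 ^+ M)^-1 in
  nondyadic (x0 - t) /\ nondyadic (x0 + t).
Proof.
move=> im mM x0 t.
have m0 := exp2_gt0 m; have M0 := exp2_gt0 M.
have t0 : 0 < t by rewrite invr_gt0 mulr_gt0.
have tm : t < 2^-1 / 2 ^+ m.
  rewrite -invfM ltf_pV2 ?posrE ?mulr_gt0//.
  rewrite -exprS (@le_lt_trans _ _ (2 ^+ M))// ?ler_eXn2l ?ltr1n//.
  by rewrite ltr_pMl// ltr1n.
have x0l : 2^-1 / 2 ^+ m <= x0 by rewrite ler_pM2r ?invr_gt0// lerDr.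
have x0r : x0 + 2^-1 / 2 ^+ m <= 1.
  rewrite -mulrDl ler_pdivrMr// mul1r.
  have : i.+1%:R <= (2 ^ m)%:R :> R by rewrite ler_nat.
  by rewrite natrX -natr1; lra.
split; split; try by apply/andP; split; lra.
  (* The midpoint has denominator 2^(m+1), hence the argument [m.+1] below. *)
  move=> n l /(congr1 ( *%R^~ (2 * 2 ^+ m * 3 * 2 ^+ M))) /= E.
  have [_] := thirds_not_dyadic i n m.+1 M l; apply.
  apply/eqP; rewrite -(eqr_nat R) !natrD !natrM natrD natrM !natrX; apply/eqP.
  rewrite [X in _ = X + _](_ : _ = l%:R * (2 * 2 ^+ m * 3 * 2 ^+ M)).
    by rewrite -E /x0 /t exprS; field; rewrite !lt0r_neq0.
  by rewrite exprS; ring.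
move=> n l /(congr1 ( *%R^~ (2 * 2 ^+ m * 3 * 2 ^+ M))) /= E.
have [+ _] := thirds_not_dyadic i n m.+1 M l; apply.
apply/eqP; rewrite -(eqr_nat R) !natrD !natrM natrD natrM !natrX; apply/eqP.
rewrite [RHS](_ : _ = l%:R * (2 * 2 ^+ m * 3 * 2 ^+ M)).
  by rewrite -E /x0 /t exprS; field; rewrite !lt0r_neq0.
by rewrite exprS; ring.
Qed.

End dyadic_numbers.

(** * Points and segments that avoid the slits *)

Section slit_domain_geometry.
Context {R : realType}.
Variable a : nat -> R.
Hypothesis a_itv : forall i : nat, (0 < i)%N -> 0 < a i < 1.
Local Notation S := (slit_domain a).
Local Notation inf := (path_inf S).

(** This keeps every slit away from the horizontal sides of its cell, where the slit line can be
    crossed. *)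
Lemma half_slit_lt n : (0 < n)%N -> a n / 2 ^+ n.+1 / 2 < 2^-1 / 2 ^+ n.
Proof.
move=> /a_itv /andP[a0 a1]; have n0 := @exp2_gt0 R n.
rewrite (_ : a n / 2 ^+ n.+1 / 2 = a n / 4 / 2 ^+ n).
  by rewrite ltr_pM2r ?invr_gt0//; lra.
by rewrite exprS; field; rewrite lt0r_neq0.
Qed.

Lemma slit_domainP (x y : R) : 0 <= x <= 1 -> 0 <= y <= 1 ->
  (forall n l k : nat, (0 < n)%N -> (l < 2 ^ n)%N -> (k < 2 ^ n)%N ->
    x = (l%:R + 2^-1) / 2 ^+ n ->
    a n / 2 ^+ n.+1 / 2 < `|y - (k%:R + 2^-1) / 2 ^+ n|) ->
  S (x, y).
Proof.
move=> x01 y01 H; split => // -[n [l [k [n0 ln kn [/= xE]]]]].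
by rewrite leNgt (H _ _ _ n0 ln kn xE).
Qed.

Lemma slit_domain_vertical (x y : R) : 0 <= x <= 1 -> 0 <= y <= 1 ->
  (forall n l, (0 < n)%N -> (l < 2 ^ n)%N -> x <> (l%:R + 2^-1) / 2 ^+ n) ->
  S (x, y).
Proof.
by move=> x01 y01 H; apply: slit_domainP => // n l k n0 ln kn /H; case.
Qed.

Lemma slit_domain_nondyadic (x y : R) : nondyadic x -> 0 <= y <= 1 -> S (x, y).
Proof.
move=> xnd y01; apply: slit_domain_vertical => // [|n l _ _].
  by case: xnd => /andP[/ltW -> /ltW ->].
exact: nondyadic_neq_midpoint.
Qed.

(* Inside an open strip of width 2^-m all slits have scale at least m, and the
   heights k 2^-m are cell boundaries for all these scales. *)
Lemma slit_domain_grid (m i k : nat) (x : R) :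
  (i < 2 ^ m)%N -> (k <= 2 ^ m)%N ->
  i%:R / 2 ^+ m < x < i.+1%:R / 2 ^+ m -> S (x, k%:R / 2 ^+ m).
Proof.
move=> im km /andP[ix xi]; have m0 := @exp2_gt0 R m.
apply: slit_domainP => [||n l k' n0 ln k'n xE].
- apply/andP; split; first by rewrite (le_trans _ (ltW ix))// divr_ge0 // ltW.
  rewrite (le_trans (ltW xi))// ler_pdivrMr// mul1r.
  by rewrite -natrX ler_nat.
- by rewrite divr_ge0 ?(ltW m0)//= ler_pdivrMr// mul1r -natrX ler_nat.
have n0' := @exp2_gt0 R n.
(* A slit abscissa of scale n < m is a multiple of 2^-m, which the open strip does not contain. *)
have [nm|mn] := ltnP n m.
  move: ix xi; rewrite ltr_pdivrMr// ltr_pdivlMr//.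
  rewrite (_ : x * 2 ^+ m = ((2 * l + 1) * 2 ^ (m - n.+1))%:R).
    by rewrite !ltr_nat ltnS => ix /(leq_trans ix); rewrite ltnn.
  rewrite xE -{1}(subnKC nm) exprD exprS natrM natrD natrM natrX.
  by field; rewrite lt0r_neq0.
rewrite (lt_le_trans (half_slit_lt n0))//.
rewrite (_ : k%:R / 2 ^+ m = (k * 2 ^ (n - m))%:R / 2 ^+ n); last first.
  by rewrite -{2}(subnKC mn) exprD natrM natrX; field; rewrite !lt0r_neq0.
rewrite -mulrBl normrM [`|2 ^- n|]gtr0_norm ?invr_gt0//.
by rewrite ler_pM2r ?invr_gt0// half_gap.
Qed.

Lemma slit_domain_midpoint (m i : nat) (y : R) : (0 < m)%N -> (i < 2 ^ m)%N ->
  0 <= y <= 1 ->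
  (forall k, (k < 2 ^ m)%N ->
    a m / 2 ^+ m.+1 / 2 < `|y - (k%:R + 2^-1) / 2 ^+ m|) ->
  S ((i%:R + 2^-1) / 2 ^+ m, y).
Proof.
move=> m0 im y01 H; have m0' := @exp2_gt0 R m.
apply: slit_domainP => // [|n l k n0 ln kn /esym/dyadic_midpoint_inj nm].
  rewrite divr_ge0 ?addr_ge0 ?invr_ge0 ?(ltW m0')//= ler_pdivrMr// mul1r.
  have : i.+1%:R <= (2 ^ m)%:R :> R by rewrite ler_nat.
  by rewrite natrX -natr1; lra.
by rewrite nm in kn *; exact: H.
Qed.

Lemma path_inf_vertical (x y y' : R) :
  (forall t, Num.min y y' <= t <= Num.max y y' -> S (x, t)) ->
  (inf (x, y) (x, y') <= `|y - y'|%:E)%E.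
Proof.
move=> xS; rewrite -(euclidean_dist_vertical x); apply: path_inf_segment.
move=> t /andP[t0 t1]; rewrite /segment/= subrr mulr0 addr0; apply: xS.
rewrite ge_min le_max.
by have [yy'|yy'] := leP y y'; apply/andP; split; apply/orP; nra.
Qed.

Lemma path_inf_horizontal (x x' y : R) :
  (forall t, Num.min x x' <= t <= Num.max x x' -> S (t, y)) ->
  (inf (x, y) (x', y) <= `|x - x'|%:E)%E.
Proof.
move=> yS; rewrite -(euclidean_dist_horizontal _ _ y); apply: path_inf_segment.
move=> t /andP[t0 t1]; rewrite /segment/= subrr mulr0 addr0; apply: yS.
rewrite ge_min le_max.
by have [xx'|xx'] := leP x x'; apply/andP; split; apply/orP; nra.
Qed.

End slit_domain_geometry.

(** * Finiteness of the path metric on the slit domain *)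

Section slit_domain_connected.
Context {R : realType}.
Variable a : nat -> R.
Hypothesis a_itv : forall i : nat, (0 < i)%N -> 0 < a i < 1.
Local Notation S := (slit_domain a).
Local Notation inf := (path_inf S).

Lemma unit_cell (m : nat) (y : R) : 0 <= y <= 1 ->
  exists2 k : nat, (k < 2 ^ m)%N & k%:R / 2 ^+ m <= y <= k.+1%:R / 2 ^+ m.
Proof.
move=> /andP[y0 y1]; have m0 := @exp2_gt0 R m.
(* Height 1 belongs to the last cell; truncation would give the index 2^m, one too many. *)
move: y1; rewrite le_eqVlt => /predU1P[->|y1].
  have N0 : (0 < 2 ^ m)%N by rewrite expn_gt0.
  exists (2 ^ m).-1; first by rewrite prednK.
  rewrite prednK// natrX divff ?lt0r_neq0// lexx andbT.
  by rewrite ler_pdivrMr// mul1r -natrX ler_nat leq_pred.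
have ym0 : 0 <= y * 2 ^+ m by rewrite mulr_ge0 // ltW.
have /andP[tl tr] := Num.Theory.truncn_itv ym0.
exists (Num.truncn (y * 2 ^+ m)); last first.
  by rewrite ler_pdivrMr// ler_pdivlMr// tl ltW.
by rewrite -(ltr_nat R) natrX; apply: le_lt_trans tl _; rewrite gtr_pMl.
Qed.

Lemma cell_gap (m j k : nat) (t : R) :
  j%:R / 2 ^+ m <= t <= j.+1%:R / 2 ^+ m -> k != j ->
  2^-1 / 2 ^+ m <= `|t - (k%:R + 2^-1) / 2 ^+ m|.
Proof.
move=> /andP[jt tj].
have m0 : 0 < (2 ^+ m)^-1 :> R by rewrite invr_gt0 exp2_gt0.
rewrite neq_ltn => /orP[kj|jk].
  have kjR : k.+1%:R / 2 ^+ m <= j%:R / 2 ^+ m :> R.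
    by rewrite ler_pM2r// ler_nat.
  move: kjR; rewrite -natr1 => kjR; rewrite ger0_norm; lra.
have jkR : j.+1%:R / 2 ^+ m <= k%:R / 2 ^+ m :> R.
  by rewrite ler_pM2r// ler_nat.
rewrite ler0_norm; lra.
Qed.

(** Both directions are carried along, which makes symmetry immediate. *)
Definition joined p q := (inf p q < +oo)%E /\ (inf q p < +oo)%E.

Lemma joined_sym p q : joined p q -> joined q p.
Proof. by case. Qed.

Lemma joined_trans q p r : joined p q -> joined q r -> joined p r.
Proof.
move=> [pq qp] [qr rq]; split; apply: le_lt_trans (path_inf_triangle _ q _ _) _.
  exact: lte_add_pinfty.
exact: lte_add_pinfty.
Qed.

Lemma joined_vertical (x y y' : R) :
  (forall t, Num.min y y' <= t <= Num.max y y' -> S (x, t)) ->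
  joined (x, y) (x, y').
Proof.
move=> xS; split; first exact: le_lt_trans (path_inf_vertical xS) (ltry _).
by apply: le_lt_trans (path_inf_vertical _) (ltry _); rewrite minC maxC.
Qed.

Lemma joined_horizontal (x x' y : R) :
  (forall t, Num.min x x' <= t <= Num.max x x' -> S (t, y)) ->
  joined (x, y) (x', y).
Proof.
move=> yS; split; first exact: le_lt_trans (path_inf_horizontal yS) (ltry _).
by apply: le_lt_trans (path_inf_horizontal _) (ltry _); rewrite minC maxC.
Qed.

Lemma slit_domain_bottom (x : R) : 0 <= x <= 1 -> S (x, 0).
Proof.
move=> x01; apply: slit_domainP => // [|n l k n0 ln kn _].
  by rewrite lexx ler01.
apply: lt_le_trans (half_slit_lt a_itv n0) _.
rewrite sub0r normrN ger0_norm ?ler_pM2r ?invr_gt0 ?exp2_gt0 ?lerDr//.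
Qed.

(** The bottom side meets no slit and serves as a common road: go down vertically, then along it to
    the origin. *)
Lemma joined_unslit (x y : R) : 0 <= x <= 1 -> 0 <= y <= 1 ->
  (forall n l, (0 < n)%N -> (l < 2 ^ n)%N -> x <> (l%:R + 2^-1) / 2 ^+ n) ->
  joined (x, y) (0, 0).
Proof.
move=> /andP[x0 x1] /andP[y0 y1] H; apply: (@joined_trans (x, 0)).
  apply: joined_vertical => t; rewrite min_r// max_l// => /andP[t0 ty].
  by apply: slit_domain_vertical => //; rewrite ?x0 ?t0//= (le_trans ty).
apply: joined_horizontal => t; rewrite min_r// max_l// => /andP[t0 tx].
by apply: slit_domain_bottom; rewrite t0 (le_trans tx).
Qed.

(* From y, go vertically to the end of the level-m cell that is not behind the
   slit, then horizontally to a nondyadic abscissa. *)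
Lemma joined_slit (m i : nat) (y : R) : (0 < m)%N -> (i < 2 ^ m)%N ->
  S ((i%:R + 2^-1) / 2 ^+ m, y) -> joined ((i%:R + 2^-1) / 2 ^+ m, y) (0, 0).
Proof.
move=> m0 im [[/= x01 y01] yS]; set x := _ / _ in x01 yS *.
have w0 : 0 < (2 ^+ m)^-1 :> R by rewrite invr_gt0 exp2_gt0.
have [k0 k0m /andP[k0y yk0]] := unit_cell m y01.
have {}yS : a m / 2 ^+ m.+1 / 2 < `|y - (k0%:R + 2^-1) / 2 ^+ m|.
  by rewrite ltNge; apply/negP => le; apply: yS; exists m, i, k0.
have vS t : k0%:R / 2 ^+ m <= t <= k0.+1%:R / 2 ^+ m ->
    a m / 2 ^+ m.+1 / 2 < `|t - (k0%:R + 2^-1) / 2 ^+ m| -> S (x, t).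
  move=> tk0 tS; apply: slit_domain_midpoint => // [|k km].
    move: tk0 => /andP[t1 t2]; apply/andP; split.
      by apply: le_trans t1; rewrite divr_ge0// ltW// exp2_gt0.
    apply: le_trans t2 _.
    by rewrite ler_pdivrMr ?exp2_gt0// mul1r -natrX ler_nat.
  have [->//|kk0] := eqVneq k k0.
  by apply: lt_le_trans (half_slit_lt a_itv m0) _; exact: cell_gap tk0 kk0.
have [k km yk] : exists2 k, (k <= 2 ^ m)%N & joined (x, y) (x, k%:R / 2 ^+ m).
  move: yk0 k0y vS; rewrite -(natr1 k0) => yk0 k0y vS.
  have [le|gt] := leP ((k0%:R + 2^-1) / 2 ^+ m) y.
    exists k0.+1 => //; apply: joined_vertical => t.
    move: yS; rewrite -(natr1 k0) min_l// max_r// ger0_norm ?subr_ge0//.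
    move=> yS /andP[yt tk].
    by apply: vS; [rewrite tk (le_trans k0y)|rewrite ger0_norm; lra].
  exists k0; first exact: ltnW.
  apply: joined_vertical => t.
  move: yS; rewrite min_r// max_l// ltr0_norm ?subr_lt0// => yS /andP[yt tk].
  by apply: vS; [rewrite yt (le_trans tk)|rewrite ler0_norm; lra].
have [_] := @nondyadic_near_midpoint R m i m.+1 im (ltnSn m).
rewrite -/x; set t := _^-1 => xt.
have t0 : 0 < t by rewrite invr_gt0 mulr_gt0// exp2_gt0.
have tw : t < 2^-1 / 2 ^+ m.
  by rewrite /t exprS !invfM mulrA ltr_pM2r//; lra.
apply: joined_trans yk _; apply: (@joined_trans (x + t, k%:R / 2 ^+ m)).
  have xxt : x <= x + t by rewrite lerDl ltW.
  apply: joined_horizontal => u; rewrite min_l// max_r// => /andP[xu ut].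
  apply: (slit_domain_grid a_itv im km).
  by rewrite -natr1; move: xu ut; rewrite /x => xu ut; apply/andP; split; lra.
apply: joined_unslit.
- by case: xt => /andP[/ltW -> /ltW ->].
- rewrite divr_ge0 ?(ltW (exp2_gt0 m))//= ler_pdivrMr ?exp2_gt0//.
  by rewrite mul1r -natrX ler_nat.
- by move=> n l _ _; exact: nondyadic_neq_midpoint.
Qed.

Lemma slit_domain_joined p q : S p -> S q -> joined p q.
Proof.
suff H r : S r -> joined r (0, 0).
  by move=> /H p0 /H q0; apply: joined_trans p0 (joined_sym q0).
case: r => x y Sxy; have [[/= x01 y01] _] := Sxy.
have [[n [l [n0 ln xE]]]|nE] := pselect (exists n l : nat,
    [/\ (0 < n)%N, (l < 2 ^ n)%N & x = (l%:R + 2^-1) / 2 ^+ n]).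
  by move: Sxy; rewrite xE; exact: joined_slit.
by apply: joined_unslit => // n l n0 ln xE; apply: nE; exists n, l.
Qed.

(** Finiteness makes [fine] in [path_dist] lossless, so the metric axioms pass from [path_inf] to
    [path_dist]. *)
Lemma path_inf_fin_num p q : S p -> S q -> inf p q \is a fin_num.
Proof.
move=> Sp Sq; rewrite ge0_fin_numE ?path_inf_ge0//.
by have [] := slit_domain_joined Sp Sq.
Qed.

Lemma slit_path_distE (p q : set_type S) :
  (path_dist p q)%:E = inf (set_val p) (set_val q).
Proof. by rewrite fineK// path_inf_fin_num//; exact: set_valP. Qed.

Lemma slit_path_dist_ge0 (p q : set_type S) : 0 <= path_dist p q.
Proof. by rewrite -lee_fin slit_path_distE path_inf_ge0. Qed.

Lemma slit_path_dist_triangle (q p r : set_type S) :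
  path_dist p r <= path_dist p q + path_dist q r.
Proof. by rewrite -lee_fin EFinD !slit_path_distE path_inf_triangle. Qed.

Lemma slit_path_distxx (p : set_type S) : path_dist p p = 0.
Proof.
apply/eqP; rewrite eq_le slit_path_dist_ge0 andbT -lee_fin slit_path_distE.
rewrite -(euclidean_distxx (set_val p)); apply: path_inf_segment => t _.
by rewrite /segment !subrr !mulr0 !addr0 -surjective_pairing; exact: set_valP.
Qed.

End slit_domain_connected.

(** Take the least exponent that satisfies the lower bound; minimality gives the upper bound, except
    at exponent 0, where [l < 1] does. *)
Lemma dyadic_below (R : realType) (l : R) : 0 < l < 1 ->
  exists j : nat, (2 ^+ j)^-1 <= l < 2 / 2 ^+ j.
Proof.
move=> /andP[l0 l1].
have ex : exists j : nat, (2 ^+ j)^-1 <= l.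
  exists (Num.truncn l^-1); have l'0 : 0 <= l^-1 by rewrite invr_ge0 ltW.
  have /andP[_ tl] := Num.Theory.truncn_itv l'0.
  rewrite -[leRHS]invrK lef_pV2 ?posrE ?exp2_gt0 ?invr_gt0//.
  by rewrite (le_trans (ltW tl))// -natrX ler_nat ltn_expl.
case: (ex_minnP ex) => j jl jmin; exists j; rewrite jl /=.
case: j jl jmin => [|j] _ jmin.
  by rewrite expr0 divr1 (lt_le_trans l1)// ler1n.
rewrite exprS invfM mulVKf//; rewrite ltNge; apply/negP => /jmin.
by rewrite ltnn.
Qed.

(* The quadrilateral inequality around a slit: the vertical diagonal, of length
   2 s, is stretched to A; the horizontal one to at least c s; the sides, of
   length s, to at most s v, up to the error 2 C t of crossing the slit line at
   its end. *)
Lemma slit_gain (R : realFieldType) (c C s v t A : R) :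
  0 < c <= C -> 0 < s -> 0 <= v <= C -> 0 <= t <= c ^+ 2 * s / (32 * C ^+ 2) ->
  0 <= A ->
  A ^+ 2 + (c * s) ^+ 2 <= 2 * (s * v) ^+ 2 + 2 * (s * v + 2 * C * t) ^+ 2 ->
  A <= 2 * s * (v - c ^+ 2 / (16 * C)).
Proof.
move=> /andP[c0 cC] s0 /andP[v0 vC] /andP[t0]; have C0 : 0 < C by lra.
rewrite ler_pdivlMr ?mulr_gt0 ?exprn_gt0// => tle A0 Ale.
have ts : t <= s.
  rewrite -(ler_pM2r (_ : 0 < 32 * C ^+ 2)) ?mulr_gt0 ?exprn_gt0//.
  apply: le_trans tle _; rewrite [leRHS]mulrC ler_pM2r//.
  have : c ^+ 2 <= C ^+ 2 by rewrite ler_sqr ?nnegrE ?(ltW c0) ?(ltW C0).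
  have := sqr_ge0 C; lra.
(* The cross terms with t add up to at most 16 C^2 t s, which the bound on t makes at most c^2 s^2 /
   2: half of the gain survives. *)
have A2 : A ^+ 2 <= 4 * s ^+ 2 * v ^+ 2 - c ^+ 2 * s ^+ 2 / 2.
  have e1 : C * t * s * v <= C * t * s * C.
    by rewrite ler_wpM2l ?mulr_ge0 ?(ltW C0) ?(ltW s0).
  have e2 : C ^+ 2 * t * t <= C ^+ 2 * t * s.
    by apply: ler_wpM2l ts; rewrite mulr_ge0 ?sqr_ge0.
  have e3 : t * (32 * C ^+ 2) * s <= c ^+ 2 * s * s by rewrite ler_wpM2r // ltW.
  nra.
set k := c ^+ 2 / (16 * C).
have kC : k * C = c ^+ 2 / 16 by rewrite /k; field; rewrite lt0r_neq0.
have k0 : 0 <= k by rewrite divr_ge0 ?sqr_ge0// mulr_ge0// ltW.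
(* As [A ^+ 2] is nonnegative, v cannot be small compared with k; so [v - k] is nonnegative and
   squares can be compared. *)
have v2 : c ^+ 2 / 8 <= v ^+ 2.
  have s20 : 0 < s ^+ 2 by rewrite exprn_gt0.
  rewrite -(ler_pM2l s20); have := sqr_ge0 A; lra.
have vk : 2 * k <= v.
  rewrite -(ler_pM2r C0); have : v * v <= v * C by rewrite ler_wpM2l.
  by rewrite -mulrA kC -expr2; lra.
have vk0 : 0 <= v - k by lra.
rewrite -ler_sqr ?nnegrE ?mulr_ge0 ?(ltW s0)//.
apply: le_trans A2 _.
have vkC : v * k <= C * k by rewrite ler_wpM2r.
have : s ^+ 2 * (v * k) <= s ^+ 2 * (c ^+ 2 / 16).
  by rewrite ler_wpM2l ?sqr_ge0// -kC [leRHS]mulrC.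
have := mulr_ge0 (sqr_ge0 s) (sqr_ge0 k).
nra.
Qed.

(** * Stretching of vertical segments by the embedding *)

Section steep_segments.
Context {R : realType}.
Variable a : nat -> R.
Hypothesis a_itv : forall i : nat, (0 < i)%N -> 0 < a i < 1.
Local Notation S := (slit_domain a).
Local Notation inf := (path_inf S).
Variables (F : R * R -> ell2 R) (c C : R).
Hypothesis cC : 0 < c <= C.
Hypothesis F_le : forall p q l, S p -> S q -> (inf p q <= l%:E)%E ->
  ell2_dist (F p) (F q) <= C * l.
Hypothesis F_ge : forall p q l, S p -> S q -> (l%:E <= inf p q)%E ->
  c * l <= ell2_dist (F p) (F q).
Local Notation D p q := (ell2_dist (F p) (F q)).

Let C_gt0 : 0 < C. Proof. by move: cC => /andP[c0]; exact: lt_le_trans. Qed.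

Lemma dist_vertical_le (x y y' : R) :
  (forall t, Num.min y y' <= t <= Num.max y y' -> S (x, t)) ->
  D (x, y) (x, y') <= C * `|y - y'|.
Proof.
move=> xS; apply: F_le; [| |exact: path_inf_vertical].
  by apply: xS; rewrite ge_min le_max !lexx.
by apply: xS; rewrite ge_min le_max !lexx !orbT.
Qed.

Lemma dist_horizontal_le (x x' y : R) :
  (forall t, Num.min x x' <= t <= Num.max x x' -> S (t, y)) ->
  D (x, y) (x', y) <= C * `|x - x'|.
Proof.
move=> yS; apply: F_le; [| |exact: path_inf_horizontal].
  by apply: yS; rewrite ge_min le_max !lexx.
by apply: yS; rewrite ge_min le_max !lexx !orbT.
Qed.

Lemma dist_nondyadic_le (x y L : R) : nondyadic x ->
  0 <= y -> 0 <= L -> y + L <= 1 -> D (x, y) (x, y + L) <= C * L.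
Proof.
move=> xnd y0 L0 yL; have yyL : y <= y + L by rewrite lerDl.
apply: le_trans (dist_vertical_le _) _.
  move=> t; rewrite min_l// max_r// => /andP[yt ty].
  apply: slit_domain_nondyadic => //; rewrite (le_trans y0 yt) /=.
  exact: le_trans ty yL.
by rewrite opprD addNKr normrN ger0_norm.
Qed.

(** A path from one side to the other meets the slit line beyond the slit, so it goes at least half
    the slit length away from the height [y0] and back. *)
Lemma dist_slit_ge (m i k : nat) (t : R) : (0 < m)%N -> (i < 2 ^ m)%N ->
    (k < 2 ^ m)%N -> 0 < t ->
    let x0 := (i%:R + 2^-1) / 2 ^+ m in let y0 := (k%:R + 2^-1) / 2 ^+ m in
  S (x0 - t, y0) -> S (x0 + t, y0) ->
  c * (a m / 2 ^+ m.+1) <= D (x0 - t, y0) (x0 + t, y0).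
Proof.
move=> m0 im km t0 x0 y0 Sl Sr; apply: F_ge => //.
rewrite (_ : a m / 2 ^+ m.+1 = 2 * (a m / 2 ^+ m.+1 / 2)); last by field.
apply: (@path_inf_cross _ _ x0) => //=; first by apply/andP; split; lra.
move=> y [_ nS]; rewrite leNgt; apply/negP => /ltW lt; apply: nS.
by exists m, i, k.
Qed.

(* The height of h is y0 + 2^-j or y0 - 2^-j, just beyond an end of the slit. *)
Lemma dist_slit_end_le (m i k j : nat) (t : R) (up : bool) :
    let x0 := (i%:R + 2^-1) / 2 ^+ m in let y0 := (k%:R + 2^-1) / 2 ^+ m in
    let h := y0 + (-1) ^+ up * (2 ^+ j)^-1 in
    (0 < m)%N -> (i < 2 ^ m)%N -> (k < 2 ^ m)%N -> (m.+1 < j)%N ->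
    a m / 2 ^+ m.+1 < 2 / 2 ^+ j -> 0 < t -> t < (2 ^+ j)^-1 ->
  D (x0 - t, h) (x0 + t, h) <= C * (2 * t).
Proof.
move=> x0 y0 h m0 im km mj lj t0 ts.
have m0' := @exp2_gt0 R m; have j0' := @exp2_gt0 R j.
have w0 : 0 < (2 ^+ m)^-1 :> R by rewrite invr_gt0.
have s0 : 0 < (2 ^+ j)^-1 :> R by rewrite invr_gt0.
(* Since [m.+1 < j], both [x0] and h are multiples of 2^-j. So off [x0] the segment runs at a grid
   height inside open strips of scale j, and at [x0] it passes beyond the end of the slit. *)
set P := (2 ^ (j - m.+1))%N.
have P2 : (1 < P)%N by rewrite -{1}(expn0 2) ltn_exp2l// subn_gt0.
have jE : (2 ^ j = 2 * 2 ^ m * P)%N by rewrite -expnS -expnD subnKC// ltnW.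
have mid l : (l%:R + 2^-1) / 2 ^+ m = ((2 * l + 1) * P)%:R / 2 ^+ j :> R.
  have PR : (P%:R : R) != 0 by rewrite pnatr_eq0 -lt0n (ltn_trans _ P2).
  rewrite -[2 ^+ j](natrX _ 2 j) jE !natrM natrD natrM natrX; field.
  by rewrite PR lt0r_neq0.
have mid_lt l : (l < 2 ^ m)%N -> ((2 * l + 1) * P < 2 ^ j)%N.
  move=> lm; rewrite jE ltn_pmul2r ?(ltn_trans _ P2)//.
  by rewrite addn1 mul2n -addnn mul2n -addnn -addSn -addnS leq_add.
have mid_gt l : (1 < (2 * l + 1) * P)%N.
  by rewrite (leq_trans P2)// leq_pmull// addn1.
(* The sign is [(-1) ^+ up], so [up = true] selects the lower end. *)
pose H := if up then ((2 * k + 1) * P).-1 else ((2 * k + 1) * P).+1.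
have HE : h = H%:R / 2 ^+ j.
  rewrite /h /y0 mid /H; case: (up); rewrite ?expr1 ?expr0 ?mulN1r ?mul1r.
    rewrite -{1}(@prednK ((2 * k + 1) * P)) ?(ltn_trans _ (mid_gt k))//.
    by rewrite -(natr1 _.-1); ring.
  by rewrite -(natr1 (_ * P)) mulrDl mul1r.
have Hj : (H <= 2 ^ j)%N.
  rewrite /H; case: (up); rewrite ?mid_lt// (leq_trans (leq_pred _))//.
  by rewrite ltnW// mid_lt.
have xlr : x0 - t <= x0 + t by lra.
apply: le_trans (dist_horizontal_le _) _; last first.
  rewrite (_ : x0 - t - (x0 + t) = - (2 * t)); last by ring.
  by rewrite normrN ger0_norm// mulr_ge0// ltW.
move=> u; rewrite min_l// max_r// => /andP[lu ur].
have [ux|xu|->] := ltgtP u x0.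
- have := mid_gt i; have := mid_lt i im; set I := ((2 * i + 1) * P)%N => Ij I1.
  have xE : x0 = I.-1.+1%:R / 2 ^+ j.
    by rewrite prednK ?(ltn_trans _ I1)//; exact: mid.
  rewrite HE; apply: (@slit_domain_grid _ _ a_itv j I.-1) => //.
    exact: leq_ltn_trans (leq_pred _) Ij.
  rewrite -xE ux andbT; move: xE; rewrite -(natr1 I.-1) => xE; lra.
- have := mid_lt i im; have xE := mid i.
  set I := ((2 * i + 1) * P)%N in xE * => Ij.
  rewrite HE; apply: (@slit_domain_grid _ _ a_itv j I) => //.
  by rewrite -/x0 in xE; rewrite -xE xu -(natr1 I) mulrDl -xE; lra.
- have h01 : 0 <= h <= 1.
    rewrite HE divr_ge0 ?(ltW j0')//= ler_pdivrMr// mul1r.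
    by rewrite -natrX ler_nat.
  have sw : (2 ^+ j)^-1 < 2^-1 / 2 ^+ m :> R.
    rewrite -invfM -exprS ltf_pV2 ?posrE ?exp2_gt0//.
    by rewrite ltr_eXn2l// ltr1n.
  apply: slit_domain_midpoint => // l lm.
  have [->|lk] := eqVneq l k.
    rewrite /h addrAC subrr add0r normrM normrX normrN1 expr1n mul1r.
    by rewrite gtr0_norm//; lra.
  apply: lt_le_trans (half_slit_lt a_itv m0) _; apply: cell_gap lk.
  rewrite /h /y0 -(natr1 k).
  by case: (up); rewrite ?expr1 ?expr0 ?mulN1r ?mul1r; apply/andP; split; lra.
Qed.

Section cell.
Variables (d v : R) (m i k j : nat) (t : R).
Hypotheses (m_gt0 : (0 < m)%N) (im : (i < 2 ^ m)%N) (km : (k < 2 ^ m)%N).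
Hypotheses (dam : d <= a m) (v_le : v <= C).
Hypothesis flat : forall x y L, nondyadic x -> 0 <= y -> y + L <= 1 ->
  d / 4 / 2 ^+ m <= L -> D (x, y) (x, y + L) <= v * L.
Hypothesis j_itv : (2 ^+ j)^-1 <= a m / 2 ^+ m.+1 < 2 / 2 ^+ j.
Let x0 : R := (i%:R + 2^-1) / 2 ^+ m.
Hypotheses (xl : nondyadic (x0 - t)) (xr : nondyadic (x0 + t)).
Hypotheses (t_gt0 : 0 < t) (t_le : t <= c ^+ 2 * (2 ^+ j)^-1 / (32 * C ^+ 2)).

(* [flat] says that slopes of f are at most v at the scale of the slit; crossing a
   whole cell next to its slit, the slope drops below v. *)
Lemma dist_cell_le :
  D (x0 - t, k%:R / 2 ^+ m) (x0 - t, k.+1%:R / 2 ^+ m) <=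
  (v - c ^+ 2 / (32 * C) * d) / 2 ^+ m.
Proof.
have /andP[c0 cleC] := cC.
have w0 : 0 < (2 ^+ m)^-1 :> R by rewrite invr_gt0 exp2_gt0.
have s0 : 0 < (2 ^+ j)^-1 :> R by rewrite invr_gt0 exp2_gt0.
have /andP[am0 am1] := a_itv m_gt0.
have lE : a m / 2 ^+ m.+1 = a m / 2 / 2 ^+ m by rewrite exprS invfM mulrA.
have mj : (m.+1 < j)%N.
  have : (2 ^+ j)^-1 < (2 ^+ m.+1)^-1 :> R.
    case/andP: j_itv => jl _; apply: le_lt_trans jl _.
    by rewrite gtr_pMl// invr_gt0 exp2_gt0.
  by rewrite ltf_pV2 ?posrE ?exp2_gt0// ltr_eXn2l// ltr1n.
have sw4 : (2 ^+ j)^-1 <= (2 ^+ m)^-1 / 4 :> R.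
  have : (2 ^+ j)^-1 <= (2 ^+ m.+2)^-1 :> R.
    by rewrite lef_pV2 ?posrE ?exp2_gt0// ler_eXn2l// ltr1n.
  rewrite !exprS !invfM; lra.
have [jl jr] := andP j_itv.
have t_le' := t_le.
set s := (2 ^+ j)^-1 in s0 sw4 jl jr t_le' *.
set w := (2 ^+ m)^-1 in w0 sw4 *.
have wam : d * w <= a m * w by rewrite ler_pM2r.
have amw : a m * w < w by rewrite gtr_pMl.
rewrite lE -/w in jl jr.
have c2C2 : c ^+ 2 <= C ^+ 2.
  by rewrite ler_pXn2r ?nnegrE ?(ltW c0) ?(ltW C_gt0).
have t_s : t < s.
  apply: le_lt_trans t_le' _; rewrite ltr_pdivrMr ?mulr_gt0 ?exprn_gt0//.
  rewrite mulrC ltr_pM2l//; have : 0 < C ^+ 2 by rewrite exprn_gt0.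
  lra.
set y0 := (k%:R + 2^-1) * w.
have k1w : k%:R * w + w <= 1.
  rewrite -{2}[w]mul1r -mulrDl natr1 ler_pdivrMr ?exp2_gt0// mul1r.
  by rewrite -natrX ler_nat.
have kw0 : 0 <= k%:R * w by rewrite mulr_ge0// ltW.
have y0E : y0 = k%:R * w + w / 2 by rewrite /y0; ring.
(* The pieces of the cell have lengths s and w / 2 - s. Both reach the threshold d w / 4 of [flat],
   since d w <= a_m w < 4 s and s <= w / 4. *)
have low x : nondyadic x -> D (x, k%:R * w) (x, y0 - s) <= v * (w / 2 - s).
  move=> xnd; rewrite [y0 - s](_ : _ = k%:R * w + (w / 2 - s)); last first.
    by rewrite y0E; ring.
  by apply: flat => //; rewrite -/w; lra.
have high x : nondyadic x -> D (x, y0 + s) (x, k.+1%:R * w) <= v * (w / 2 - s).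
  move=> xnd; rewrite [_.+1%:R * w](_ : _ = y0 + s + (w / 2 - s)); last first.
    by rewrite y0E -natr1; field.
  by apply: flat => //; rewrite -/w; lra.
have below x : nondyadic x -> D (x, y0 - s) (x, y0) <= v * s.
  move=> xnd; rewrite -{2}(subrK s y0).
  by apply: flat => //; rewrite -/w; lra.
have above x : nondyadic x -> D (x, y0) (x, y0 + s) <= v * s.
  by move=> xnd; apply: flat => //; rewrite -/w; lra.
have v0 : 0 <= v.
  rewrite -(pmulr_lge0 _ s0); apply: le_trans (above _ xl).
  exact: ell2_dist_ge0.
have ends (up : bool) : D (x0 - t, y0 + (-1) ^+ up * s)
    (x0 + t, y0 + (-1) ^+ up * s) <= C * (2 * t).
  by apply: dist_slit_end_le => //; rewrite lE -/w -/s; lra.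
have Sy0 x : nondyadic x -> S (x, y0).
  by move=> xnd; apply: slit_domain_nondyadic => //; apply/andP; split; lra.
have across : c * s <= D (x0 - t, y0) (x0 + t, y0).
  apply: le_trans (dist_slit_ge m_gt0 im km t_gt0 (Sy0 _ xl) (Sy0 _ xr)).
  by rewrite ler_pM2l// lE -/w; lra.
have := @slit_gain _ c C s v t (D (x0 - t, y0 - s) (x0 - t, y0 + s)).
move=> /(_ cC s0) gain.
have {gain} : D (x0 - t, y0 - s) (x0 - t, y0 + s) <=
    2 * s * (v - c ^+ 2 / (16 * C)).
  apply: gain; rewrite ?v0 ?(ltW t_gt0) ?ell2_dist_ge0//.
  apply: (@le_trans _ _ (D (x0 - t, y0 - s) (x0 - t, y0 + s) ^+ 2 +
                         D (x0 - t, y0) (x0 + t, y0) ^+ 2)).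
    rewrite lerD2l ler_pXn2r ?nnegrE ?ell2_dist_ge0//.
    by rewrite mulr_ge0// ltW.
  (* Three vertices lie on the line [x0 - t], and the two sides there cost s v each. The two sides
     to [(x0 + t, y0)] pass around the ends of the slit, at the extra cost 2 C t. *)
  apply: le_trans (ell2_quadrilateral _ (F (x0 - t, y0)) _ _) _.
  have sq (u b : R) : 0 <= u -> u <= b -> u ^+ 2 <= b ^+ 2.
    by move=> u0 ub; rewrite ler_pXn2r ?nnegrE// (le_trans u0).
  have q1 := sq _ _ (ell2_dist_ge0 _ _) (below _ xl).
  have q2 := sq _ _ (ell2_dist_ge0 _ _) (above _ xl).
  have q3 : D (x0 - t, y0 + s) (x0 + t, y0) ^+ 2 <= (s * v + 2 * C * t) ^+ 2.
    apply: sq; first exact: ell2_dist_ge0.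
    apply: le_trans (ell2_dist_triangle (F (x0 + t, y0 + s)) _ _) _.
    have := ends false; rewrite expr0 mul1r.
    by have := above _ xr; rewrite (ell2_distC (F (x0 + t, y0))); lra.
  have q4 : D (x0 + t, y0) (x0 - t, y0 - s) ^+ 2 <= (s * v + 2 * C * t) ^+ 2.
    apply: sq; first exact: ell2_dist_ge0.
    apply: le_trans (ell2_dist_triangle (F (x0 + t, y0 - s)) _ _) _.
    have := ends true; rewrite expr1 mulN1r ell2_distC.
    by have := below _ xr; rewrite (ell2_distC _ (F (x0 + t, y0))); lra.
  by rewrite ![v * s]mulrC in q1 q2; lra.
move=> middle.
apply: le_trans (ell2_dist_triangle (F (x0 - t, y0 - s)) _ _) _.
apply: le_trans (lerD (low _ xl)
  (ell2_dist_triangle (F (x0 - t, y0 + s)) _ _)) _.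
apply: le_trans (lerD (lexx _) (lerD middle (high _ xl))) _.
have kE : c ^+ 2 / (16 * C) = 2 * (c ^+ 2 / (32 * C)).
  by field; rewrite lt0r_neq0.
rewrite kE; set th := c ^+ 2 / (32 * C).
have th0 : 0 < th by rewrite divr_gt0 ?exprn_gt0// mulr_gt0.
(* The pieces add up to v w - 4 [th] s, and 4 s is at least d w. *)
have : th * (d * w) <= th * (4 * s) by rewrite ler_pM2l//; lra.
lra.
Qed.

End cell.

(** The detour consists of two vertical end pieces at x, two horizontal moves at grid heights, each
    of these four of length at most w, and whole cells at x' in between. *)
Lemma dist_refine (m i : nat) (x x' y L B : R) :
    let w := (2 ^+ m)^-1 in
    nondyadic x -> nondyadic x' -> (i < 2 ^ m)%N ->
    i%:R * w < x < i.+1%:R * w -> i%:R * w < x' < i.+1%:R * w ->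
    0 <= y -> y + L <= 1 -> 2 * w <= L -> 0 <= B ->
    (forall k, (k < 2 ^ m)%N -> D (x', k%:R * w) (x', k.+1%:R * w) <= B * w) ->
  D (x, y) (x, y + L) <= 4 * (C * w) + B * L.
Proof.
move=> w xnd xnd' im xi xi' y0 yL wL B0 cell.
have W0 := @exp2_gt0 R m.
have w0 : 0 < w by rewrite invr_gt0.
have wW : w * 2 ^+ m = 1 by rewrite mulVf// lt0r_neq0.
have L0 : 0 < L by lra.
have cells k n : (k + n <= 2 ^ m)%N ->
    D (x', k%:R * w) (x', (k + n)%:R * w) <= B * (n%:R * w).
  elim: n => [|n IHn] kn.
    have := @dist_nondyadic_le x' (k%:R * w) 0 xnd'.
    rewrite addn0 !addr0 mul0r !mulr0; apply => //.
      by rewrite mulr_ge0// ltW.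
    by rewrite ler_pdivrMr// mul1r -natrX ler_nat -[k]addn0.
  apply: le_trans (ell2_dist_triangle (F (x', (k + n)%:R * w)) _ _) _.
  rewrite addnS in kn *.
  apply: le_trans (lerD (IHn (ltnW kn)) (cell _ kn)) _.
  by rewrite -(natr1 n) mulrDl mul1r mulrDr.
have shift k : (k <= 2 ^ m)%N -> D (x, k%:R * w) (x', k%:R * w) <= C * w.
  move=> km; apply: le_trans (dist_horizontal_le _) _.
    move=> u /andP[u1 u2]; apply: (slit_domain_grid a_itv im km); rewrite -/w.
    move: xi xi' => /andP[xi1 xi2] /andP[xi1' xi2']; apply/andP; split.
      by apply: lt_le_trans u1; rewrite lt_min xi1.
    by apply: le_lt_trans u2 _; rewrite gt_max xi2.
  rewrite ler_pM2l// ler_norml; move: xi xi'.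
  rewrite -(natr1 i) mulrDl mul1r => /andP[xi1 xi2] /andP[xi1' xi2'].
  by clear -xi1 xi2 xi1' xi2'; apply/andP; split; lra.
have yW : 0 <= y * 2 ^+ m by rewrite mulr_ge0// ltW.
have yLW : 0 <= (y + L) * 2 ^+ m by rewrite mulr_ge0 ?addr_ge0 ?(ltW L0)// ltW.
have /andP[k1l k1r] := Num.Theory.truncn_itv yW.
have /andP[k2l k2r] := Num.Theory.truncn_itv yLW.
(* The detour uses the grid heights [k0.+1] and [k2], in this order because 2 w <= L. *)
set k0 := Num.truncn (y * 2 ^+ m) in k1l k1r.
set k2 := Num.truncn ((y + L) * 2 ^+ m) in k2l k2r.
have yk1 : y <= k0.+1%:R * w by rewrite ler_pdivlMr// ltW.
have k1y : k0.+1%:R * w <= y + w.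
  by rewrite -(natr1 k0) mulrDl mul1r lerD2r ler_pdivrMr.
have k2y : k2%:R * w <= y + L by rewrite ler_pdivrMr.
have yk2 : y + L <= k2%:R * w + w.
  by rewrite -{2}[w]mul1r -mulrDl natr1 ler_pdivlMr// ltW.
have {}k12 : (k0 < k2)%N.
  by rewrite -(ler_nat R) -(ler_pM2r w0); clear -yk2 k1y wL; lra.
have k2m : (k2 <= 2 ^ m)%N.
  rewrite -(ler_nat R) natrX; apply: le_trans k2l _.
  by rewrite -[leRHS]mul1r ler_pM2r.
have k1m := leq_trans k12 k2m.
have top : k2%:R * w <= 1 by exact: le_trans k2y yL.
have seg1 : D (x, y) (x, k0.+1%:R * w) <= C * w.
  rewrite -[k0.+1%:R * w](subrKC y).
  apply: le_trans (dist_nondyadic_le xnd y0 _ _) _.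
  - by rewrite subr_ge0.
  - by rewrite subrKC (le_trans _ top)// ler_pM2r// ler_nat.
  - by rewrite ler_pM2l// lerBlDl.
have seg2 : D (x, k2%:R * w) (x, y + L) <= C * w.
  rewrite -[y + L](subrKC (k2%:R * w)).
  apply: le_trans (dist_nondyadic_le xnd _ _ _) _.
  - by rewrite mulr_ge0// ltW.
  - by rewrite subr_ge0.
  - by rewrite subrKC.
  - by rewrite ler_pM2l// lerBlDl.
have seg3 : D (x', k0.+1%:R * w) (x', k2%:R * w) <= B * L.
  rewrite -{1}(subnKC k12); apply: le_trans (cells _ _ _) _.
    by rewrite subnKC.
  by rewrite ler_wpM2l// natrB// mulrBl; clear -k2y yk1; lra.
have s1 := shift _ k1m; have s2 := shift _ k2m.
rewrite ell2_distC in s2.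
have t1 := ell2_dist_triangle (F (x, k0.+1%:R * w)) (F (x, y)) (F (x, y + L)).
have t2 := ell2_dist_triangle (F (x', k0.+1%:R * w)) (F (x, k0.+1%:R * w))
  (F (x, y + L)).
have t3 := ell2_dist_triangle (F (x', k2%:R * w)) (F (x', k0.+1%:R * w))
  (F (x, y + L)).
have t4 := ell2_dist_triangle (F (x, k2%:R * w)) (F (x', k2%:R * w))
  (F (x, y + L)).
by clear -seg1 seg2 seg3 s1 s2 t1 t2 t3 t4; lra.
Qed.

(* [theta * d] is the drop of slope in [dist_cell_le]; [eta] is such that moving a
   segment of length L by eta d L costs less than half of that drop. *)
Let theta := c ^+ 2 / (32 * C).
Let eta := theta / (16 * C).

Let theta_gt0 : 0 < theta.
Proof.
by have /andP[c0 _] := cC; rewrite divr_gt0 ?exprn_gt0// mulr_gt0.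
Qed.

Let eta_gt0 : 0 < eta.
Proof. by rewrite divr_gt0// mulr_gt0. Qed.

Let eta_le : eta <= 2^-1.
Proof.
have /andP[c0 cleC] := cC.
rewrite /eta /theta -mulrA -invfM ler_pdivrMr ?mulr_gt0//.
have : c ^+ 2 <= C ^+ 2 by rewrite ler_pXn2r ?nnegrE ?(ltW c0) ?(ltW C_gt0).
by have := sqr_ge0 C; lra.
Qed.

(** Otherwise all segments of the allowed lengths have slope at most v + theta d / 2, so cells next
    to slits have slope at most v - theta d / 2. Moving the given segment there costs 4 C w <= theta
    d L / 4, which contradicts its slope v. *)
Lemma steepen (N : nat) (d v x y L : R) :
    0 < d < 1 -> (forall n, (0 < n <= N)%N -> d <= a n) ->
    nondyadic x -> 0 <= y -> y + L <= 1 -> 0 < L ->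
    (2 ^+ N)^-1 <= eta * d * L / 2 ->
    v * L <= D (x, y) (x, y + L) ->
  exists x' y' L' : R, [/\ nondyadic x', 0 <= y', y' + L' <= 1,
    eta * d ^+ 2 / 8 * L <= L' &
    (v + theta / 2 * d) * L' <= D (x', y') (x', y' + L')].
Proof.
move=> /andP[d0 d1] da xnd y0 yL L0 NL steep.
have /andP[c0 cleC] := cC.
apply: contrapT => nex.
(* The minimum with C, itself a bound for all slopes, provides the hypothesis [v_le] of
   [dist_cell_le]. *)
pose v' := Num.min (v + theta / 2 * d) C.
have flat x' y' L' : nondyadic x' -> 0 <= y' -> y' + L' <= 1 ->
    eta * d ^+ 2 / 8 * L <= L' -> D (x', y') (x', y' + L') <= v' * L'.
  move=> xnd' y0' yL' LL'.
  have L'0 : 0 <= L'.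
    apply: le_trans LL'; apply: mulr_ge0; last exact: ltW.
    by rewrite divr_ge0// mulr_ge0 ?sqr_ge0// ltW.
  rewrite /v'; have [_|_] := leP (v + theta / 2 * d) C.
    rewrite leNgt; apply/negP => /ltW st; apply: nex.
    by exists x', y', L'.
  exact: dist_nondyadic_le.
have v'C : v' <= C by rewrite ge_min lexx orbT.
have v'v : v' <= v + theta / 2 * d by rewrite ge_min lexx.
have ed0 : 0 < eta * d by rewrite mulr_gt0.
have ed1 : eta * d <= 2^-1.
  apply: le_trans eta_le; rewrite ler_piMr//; exact: ltW.
have L1 : L <= 1 by lra.
have edL : 0 < eta * d * L < 1.
  rewrite mulr_gt0//= (@le_lt_trans _ _ (eta * d))//; last by lra.
  by rewrite ler_piMr// ltW.
(* Now w = 2^-m lies between eta d L / 2 and eta d L. Hence m <= N by the hypothesis on N, and d w /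
   4 is at least eta d^2 L / 8, the least length allowed in the conclusion. *)
have [m /andP[mle mgt]] := dyadic_below edL.
have W0 := @exp2_gt0 R m.
set w := (2 ^+ m)^-1 in mle mgt.
have w0 : 0 < w by rewrite invr_gt0.
have wW : w * 2 ^+ m = 1 by rewrite mulVf// lt0r_neq0.
have m0 : (0 < m)%N.
  rewrite lt0n; apply/eqP => mE; move: mle; rewrite /w mE expr0 invr1.
  by move: edL => /andP[_]; lra.
have mN : (m <= N)%N.
  have : (2 ^+ N)^-1 < w by lra.
  rewrite ltf_pV2 ?posrE ?exp2_gt0// ltr_eXn2l ?ltr1n//; exact: ltnW.
have dam : d <= a m by apply: da; rewrite m0.
have /andP[am0 am1] := a_itv m0.
have flatw x' y' L' : nondyadic x' -> 0 <= y' -> y' + L' <= 1 ->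
    d / 4 / 2 ^+ m <= L' -> D (x', y') (x', y' + L') <= v' * L'.
  move=> xnd' y0' yL' LL'; apply: flat => //; apply: le_trans LL'.
  have : d * (eta * d * L) <= d * (2 * w) by rewrite ler_pM2l// ltW.
  rewrite -/w; lra.
have l_itv : 0 < a m / 2 ^+ m.+1 < w.
  rewrite exprS invfM -/w mulrA pmulr_lgt0// divr_gt0//=.
  by rewrite gtr_pMl//; lra.
have w1 : w <= 1 by have := edL; lra.
have [j j_itv] : exists j : nat, (2 ^+ j)^-1 <= a m / 2 ^+ m.+1 < 2 / 2 ^+ j.
  by apply: dyadic_below; move: l_itv => /andP[-> l1] /=; lra.
have s0 : 0 < (2 ^+ j)^-1 :> R by rewrite invr_gt0 exp2_gt0.
have sw : (2 ^+ j)^-1 < w.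
  by move: j_itv l_itv => /andP[jl _] /andP[_]; exact: le_lt_trans.
have c2C2 : c ^+ 2 <= C ^+ 2.
  by rewrite ler_pXn2r ?nnegrE ?(ltW c0) ?(ltW C_gt0).
have C20 : 0 < C ^+ 2 by rewrite exprn_gt0.
(* The bound on the offset t in [dist_cell_le]; M is then chosen with 2^-M <= q. *)
set q := c ^+ 2 * (2 ^+ j)^-1 / (32 * C ^+ 2).
have q0 : 0 < q by rewrite divr_gt0 ?mulr_gt0 ?exprn_gt0.
have qs : q < (2 ^+ j)^-1.
  rewrite ltr_pdivrMr ?mulr_gt0// mulrC ltr_pM2l//; lra.
have [M /andP[Mq _]] : exists M : nat, (2 ^+ M)^-1 <= q < 2 / 2 ^+ M.
  by apply: dyadic_below; rewrite q0/=; lra.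
have mM : (m < M)%N.
  have : (2 ^+ M)^-1 < w by lra.
  by rewrite ltf_pV2 ?posrE ?exp2_gt0// ltr_eXn2l ?ltr1n.
have [i im xi] := nondyadic_strip m xnd.
pose x0 : R := (i%:R + 2^-1) / 2 ^+ m.
have := @nondyadic_near_midpoint R m i M im mM.
rewrite /= -/x0; set t := (3 * 2 ^+ M)^-1 => -[xl xr].
have t0 : 0 < t by rewrite invr_gt0 mulr_gt0// exp2_gt0.
have tq : t <= q.
  apply: le_trans Mq; rewrite lef_pV2 ?posrE ?mulr_gt0 ?exp2_gt0//.
  by rewrite ler_peMl ?(ltW (exp2_gt0 M))// ler1n.
have tw : t < w / 4.
  apply: le_lt_trans tq _; rewrite ltr_pdivrMr ?mulr_gt0//.
  have : c ^+ 2 * (2 ^+ j)^-1 <= C ^+ 2 * (2 ^+ j)^-1 by rewrite ler_pM2r.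
  have : C ^+ 2 * (2 ^+ j)^-1 < C ^+ 2 * w by rewrite ltr_pM2l.
  have := mulr_gt0 C20 w0; lra.
have cell k : (k < 2 ^ m)%N ->
    D (x0 - t, k%:R * w) (x0 - t, k.+1%:R * w) <= (v' - theta * d) * w.
  by move=> km; apply: dist_cell_le xl xr t0 tq.
have vth : 0 <= v' - theta * d.
  rewrite -(pmulr_lge0 _ w0); apply: le_trans (cell 0%N _).
    exact: ell2_dist_ge0.
  by rewrite expn_gt0.
have wL : 2 * w <= L.
  apply: (@le_trans _ _ (2 * (eta * d * L))); first by rewrite ler_pM2l.
  by have : eta * d * L <= 2^-1 * L by [rewrite ler_pM2r]; lra.
have xl_strip : i%:R / 2 ^+ m < x0 - t < i.+1%:R / 2 ^+ m.
  have -> : x0 = i%:R * w + w / 2 by rewrite /x0 -/w; ring.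
  by rewrite -/w -(natr1 i) mulrDl mul1r; apply/andP; split; lra.
have /(le_trans steep) := dist_refine xnd xl im xi xl_strip y0 yL wL vth cell.
rewrite -/w.
have : C * w <= C * (eta * d * L) by rewrite ler_pM2l.
rewrite (_ : C * (eta * d * L) = theta * d * L / 16); last first.
  by rewrite /eta; field; rewrite lt0r_neq0.
have : (v' - theta * d) * L <= (v - theta / 2 * d) * L.
  by rewrite ler_pM2r//; lra.
have : 0 < theta * d * L by rewrite mulr_gt0// mulr_gt0.
lra.
Qed.

Lemma steep_iter (N : nat) (d : R) (k : nat) : 0 < d < 1 ->
    (forall n, (0 < n <= N)%N -> d <= a n) ->
    (2 ^+ N)^-1 <= (eta * d ^+ 2 / 8) ^+ k ->
  exists x y L : R, [/\ nondyadic x, 0 <= y, y + L <= 1,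
    (eta * d ^+ 2 / 8) ^+ k <= L &
    k%:R * (theta / 2 * d) * L <= D (x, y) (x, y + L)].
Proof.
move=> d01 da; have /andP[d0 d1] := d01.
set r := eta * d ^+ 2 / 8.
have r0 : 0 < r by rewrite divr_gt0// mulr_gt0// exprn_gt0.
have d2 : d ^+ 2 <= d by rewrite expr2 ger_pMl// ltW.
have r1 : r <= 1.
  have : eta * d ^+ 2 <= 2^-1 * 1.
    by apply: ler_pM; rewrite ?sqr_ge0 ?(ltW eta_gt0)//; lra.
  by rewrite /r; lra.
elim: k => [_|k IHk rk].
  (* The iteration starts from the full vertical line at abscissa 1/2 - 1/6 = 1/3, with slope bound
     0. *)
  have [xnd _] := @nondyadic_near_midpoint R 0 0 1 isT isT.
  exists ((0%:R + 2^-1) / 2 ^+ 0 - (3 * 2 ^+ 1)^-1), 0, 1; split.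
  - exact: xnd.
  - exact: lexx.
  - by rewrite add0r.
  - by rewrite expr0.
  - by rewrite !mul0r ell2_dist_ge0.
have [|x [y [L [xnd y0 yL rL steep]]]] := IHk.
  by apply: le_trans rk _; rewrite exprS ger_pMl// exprn_gt0.
have L0 : 0 < L by apply: lt_le_trans rL; rewrite exprn_gt0.
have NL : (2 ^+ N)^-1 <= eta * d * L / 2.
  apply: le_trans rk _; rewrite exprS.
  apply: (@le_trans _ _ (r * L)); first by rewrite ler_pM2l.
  rewrite /r; have : eta * L * d ^+ 2 <= eta * L * d.
    by rewrite ler_pM2l// mulr_gt0.
  have := mulr_gt0 (mulr_gt0 eta_gt0 L0) (exprn_gt0 2 d0); lra.
have [x' [y' [L' [xnd' y0' yL' LL' steep']]]] :=
  steepen d01 da xnd y0 yL L0 NL steep.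
exists x', y', L'; split => //.
  by apply: le_trans LL'; rewrite exprS ler_pM2l.
by apply: le_trans steep'; rewrite -(natr1 k) mulrDl mul1r.
Qed.

(** The slope reached after k steps cannot exceed the Lipschitz constant C. *)
Lemma steep_bound (N : nat) (d : R) (k : nat) : 0 < d < 1 ->
    (forall n, (0 < n <= N)%N -> d <= a n) ->
  (2 ^+ N)^-1 <= (eta * d ^+ 2 / 8) ^+ k -> k%:R * (theta / 2 * d) <= C.
Proof.
move=> d01 da /(steep_iter d01 da)[x [y [L [xnd y0 yL rL steep]]]].
have L0 : 0 < L.
  apply: lt_le_trans rL; have /andP[d0 _] := d01.
  by rewrite exprn_gt0// divr_gt0// mulr_gt0// exprn_gt0.
rewrite -(ler_pM2r L0); apply: le_trans steep _.
exact: dist_nondyadic_le (ltW L0) yL.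
Qed.

End steep_segments.

(** * From the bound on the number of scales to summability *)

Section condensation.
Context {R : realType}.
Implicit Types (u : nat -> R).

(** Cauchy condensation: the block from 2^k to 2^(k+1) - 1 is at most 2^k u(2^k), and these bounds
    form a geometric series. *)
Lemma condensation_bound u (r B : R) : 0 <= r < 1 ->
  (forall i, 0 <= u i) -> (forall i j, (0 < i <= j)%N -> u j <= u i) ->
  (forall k, 2 ^+ k * u (2 ^ k)%N <= B * r ^+ k) ->
  (\sum_(1 <= i <oo) (u i)%:E < +oo)%E.
Proof.
move=> /andP[r0 r1] u0 umono uB.
have B0 : 0 <= B.
  by have := uB 0%N; rewrite !expr0 mul1r mulr1; exact: le_trans (u0 _).
have blocks k : \sum_(1 <= i < 2 ^ k) u i <= \sum_(i < k) B * r ^+ i.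
  elim: k => [|k IHk]; first by rewrite big_geq// big_ord0.
  rewrite big_ord_recr/= (big_cat_nat (n := (2 ^ k)%N)) ?expn_gt0 ?leq_exp2l//=.
  apply: lerD IHk _; apply: le_trans (uB k).
  rewrite (le_trans (ler_sum_nat (G := fun=> u (2 ^ k)%N) _))//.
    by move=> i /andP[ki _]; apply: umono; rewrite expn_gt0.
  rewrite sumr_const_nat expnS mul2n -addnn addnK.
  by rewrite -[X in X <= _]mulr_natl natrX.
have geo k : \sum_(i < k) B * r ^+ i <= B / (1 - r).
  rewrite -mulr_sumr ler_wpM2l// -div1r ler_pdivlMr ?subr_gt0//.
  have := subrX1 r k; have := exprn_ge0 k r0; lra.
apply: (@le_lt_trans _ _ (B / (1 - r))%:E); last exact: ltry.
apply: lime_le; first by apply: is_cvg_nneseries => i _ _; rewrite lee_fin.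
apply: nearW => n; rewrite sumEFin lee_fin.
apply: le_trans (geo n); apply: le_trans (blocks n).
have [n1|n1] := leqP n 1; first by rewrite big_geq// sumr_ge0.
rewrite [leRHS](big_cat_nat (n := n)) ?(ltnW n1)//=; last exact/ltnW/ltn_expl.
by rewrite lerDl sumr_ge0.
Qed.

End condensation.

Lemma ln_le_powR_div (R : realType) (x p : R) : 0 < x -> 0 < p ->
  ln x <= x `^ p / p.
Proof.
move=> x0 p0; rewrite ler_pdivlMr// mulrC -ln_powR.
by rewrite ltW// ln_sublinear// powR_gt0.
Qed.

(* The exponent k is the least one with k a_N > K, so the hypothesis turns into
   N ln 2 < k ln (1 / (b a_N^2)). *)
Lemma scale_count_bound (R : realType) (q K b : R) (a : nat -> R) :
    0 < q -> 0 < b -> 0 < K ->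
    (forall i, (0 < i)%N -> 0 < a i < 1) ->
    (forall N k, (0 < N)%N -> (2 ^+ N)^-1 <= (b * a N ^+ 2) ^+ k ->
      k%:R * a N <= K) ->
  exists2 B : R, 0 <= B & forall N, (0 < N)%N -> a N `^ (1 + q) <= B / N%:R.
Proof.
move=> q0 b0 K0 a_itv H.
have h0 : 0 < q / 2 by rewrite divr_gt0.
have ln20 : 0 < ln 2 :> R by rewrite ln_gt0// ltr1n.
(* The logarithm of 1 / (b a_N^2) is bounded through its power q / 2, which yields E a_N^-q. *)
pose E := b^-1 `^ (q / 2) / (q / 2).
have E0 : 0 <= E by rewrite divr_ge0 ?powR_ge0// ltW.
exists ((K + 1) * E / ln 2).
  by apply: divr_ge0; [rewrite mulr_ge0// addr_ge0// ltW|exact: ltW].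
move=> N N0; have /andP[a0 a1] := a_itv N N0.
have NR : 0 < N%:R :> R by rewrite ltr0n.
pose k := (Num.truncn (K / a N)).+1.
have Ka0 : 0 <= K / a N by rewrite divr_ge0 // ltW.
have /andP[kl kr] := Num.Theory.truncn_itv Ka0.
have kK : K < k%:R * a N by rewrite -ltr_pdivrMr.
have rpos : 0 < b * a N ^+ 2 by rewrite mulr_gt0// exprn_gt0.
have lt : (b * a N ^+ 2) ^+ k < (2 ^+ N)^-1.
  by rewrite ltNge; apply/negP => /(H N k N0); rewrite leNgt kK.
have ineq1 : N%:R * ln 2 <= k%:R * ln (b * a N ^+ 2)^-1.
  rewrite !mulr_natl -!lnXn ?invr_gt0// ler_ln ?posrE ?exprn_gt0 ?invr_gt0//.
  rewrite exprVn -[leLHS]invrK lef_pV2 ?posrE ?invr_gt0 ?exprn_gt0//.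
  exact: ltW.
have ineq2 : k%:R <= (K + 1) / a N.
  rewrite ler_pdivlMr// -(natr1 (Num.truncn _)) mulrDl mul1r.
  by apply: lerD; [rewrite -ler_pdivlMr|exact: ltW].
have ineq3 : ln (b * a N ^+ 2)^-1 <= E / a N `^ q.
  apply: le_trans (ln_le_powR_div _ h0) _; first by rewrite invr_gt0.
  rewrite invfM powRM ?invr_ge0 ?sqr_ge0 ?(ltW b0)//.
  rewrite (_ : (a N ^+ 2)^-1 = a N `^ (- 2)); last first.
    by rewrite powRN powR_mulrn// ltW.
  rewrite -powRrM (_ : - 2 * (q / 2) = - q); last by field.
  by rewrite powRN /E mulrAC.
have aq0 : 0 < a N `^ q by rewrite powR_gt0.
have ineq : N%:R * ln 2 <= (K + 1) * E / (a N * a N `^ q).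
  apply: le_trans ineq1 _; apply: le_trans (ler_wpM2l _ ineq3) _ => //.
  apply: le_trans (ler_wpM2r _ ineq2) _; first by rewrite divr_ge0// ltW.
  by rewrite invfM mulrACA.
rewrite powRD ?gt_eqF ?addr_gt0// powRr1 ?(ltW a0)//.
rewrite ler_pdivlMr// ler_pdivlMr// -mulrA.
by move: ineq; rewrite ler_pdivlMr ?mulr_gt0// mulrC.
Qed.

(** Raised to the power s = (1 + eps) / (1 + q) > 1, the hypothesis bounds the terms by B^s N^-s;
    condensation then has ratio 2^(1-s) < 1. *)
Lemma summable_powR (R : realType) (eps q B : R) (a : nat -> R) :
    0 < q < eps -> 0 <= B ->
    (forall i, (0 < i)%N -> 0 < a i < 1) ->
    (forall i j, (0 < i)%N -> (i <= j)%N -> a j <= a i) ->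
    (forall N, (0 < N)%N -> a N `^ (1 + q) <= B / N%:R) ->
  (\sum_(1 <= i <oo) (a i `^ (1 + eps))%:E < +oo)%E.
Proof.
move=> /andP[q0 qe] B0 a_itv amono aB.
pose s := (1 + eps) / (1 + q).
have q10 : 0 < 1 + q by rewrite addr_gt0.
have s1 : 1 < s by rewrite ltr_pdivlMr// mul1r ltrD2l.
have half0 : 0 < 2^-1 :> R by [].
apply: (@condensation_bound _ _ (2 * 2^-1 `^ s) (B `^ s)).
- rewrite mulr_ge0 ?powR_ge0//= -(subrK 1 s) powRD ?(gt_eqF half0) ?implybT//.
  rewrite powRr1 ?(ltW half0)// mulrC -mulrA mulVf// mulr1.
  rewrite [ltRHS](_ : 1 = 1 `^ (s - 1)); last by rewrite powR1.
  apply: gt0_ltr_powR; rewrite ?subr_gt0 ?nnegrE ?ler01 ?(ltW half0)//.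
  by rewrite invf_lt1// ltr1n.
- by move=> i; exact: powR_ge0.
- move=> i j /andP[i0 ij]; apply: ge0_ler_powR; rewrite ?nnegrE ?amono//.
  + by rewrite addr_ge0// ltW// (lt_trans q0).
  + by have /andP[/ltW] := a_itv j (leq_trans i0 ij).
  + by have /andP[/ltW] := a_itv i i0.
- move=> k; have N0 : (0 < 2 ^ k)%N by rewrite expn_gt0.
  have -> : a (2 ^ k)%N `^ (1 + eps) = (a (2 ^ k)%N `^ (1 + q)) `^ s.
    by rewrite -powRrM /s mulrC divfK ?gt_eqF.
  have s0 : 0 <= s by rewrite ltW// (lt_trans ltr01).
  have ub := ge0_ler_powR s0 _ _ (aB _ N0).
  apply: (@le_trans _ _ (2 ^+ k * (B / (2 ^ k)%:R) `^ s)).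
    by rewrite ler_pM2l ?exp2_gt0// ub ?nnegrE ?powR_ge0 ?divr_ge0.
  rewrite powRM ?invr_ge0// exprMn natrX.
  have -> : (2 ^+ k)^-1 `^ s = (2^-1 `^ s) ^+ k :> R.
    by rewrite -exprVn -!powR_mulrn ?powR_ge0 ?(ltW half0)// -!powRrM mulrC.
  by rewrite mulrCA.
Qed.

(** * Transfer of the embedding to the plane and choice of the parameters *)

Theorem theorem6p4 (R : realType) (eps : R) (a : nat -> R)
  (eps_gt0 : 0 < eps)
  (a_noninc : forall i j : nat, (0 < i)%N -> (i <= j)%N -> a j <= a i)
  (a_itv : forall i : nat, (0 < i)%N -> 0 < a i < 1)
  (embeds : exists f : slit_carpet a -> ell2 R,
     bilipschitz_embedding (@slit_carpet_dist R a) (@ell2_dist R) f) :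
  (\sum_(1 <= i <oo) (a i `^ (1 + eps))%:E < +oo)%E.
Proof.
have [f [c [C [c0 cC fcC]]]] := embeds.
pose incl := completion_incl (slit_path_distxx a_itv).
(* The embedding read on plane points; the default 0 is taken only off the slit domain, where no
   estimate is claimed. *)
pose F (p : R * R) : ell2 R :=
  if pselect (slit_domain a p) is left Sp then
    f (incl (exist _ p (mem_set Sp)))
  else 0.
have FE p q : slit_domain a p -> slit_domain a q -> exists2 e : R,
    e%:E = path_inf (slit_domain a) p q &
    c * e <= ell2_dist (F p) (F q) <= C * e.
  move=> Sp Sq; rewrite /F.
  case: pselect => // {}Sp; case: pselect => // {}Sq.
  exists (path_dist (exist _ p (mem_set Sp)) (exist _ q (mem_set Sq))).
    exact: slit_path_distE.
  rewrite -(completion_dist_incl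
    (slit_path_distxx a_itv) (slit_path_dist_triangle a_itv)).
  exact: fcC.
have C0 : 0 < C by exact: lt_le_trans c0 cC.
have F_le p q l : slit_domain a p -> slit_domain a q ->
    (path_inf (slit_domain a) p q <= l%:E)%E -> ell2_dist (F p) (F q) <= C * l.
  move=> Sp Sq; have [e <- /andP[_ eC]] := FE _ _ Sp Sq; rewrite lee_fin => el.
  by apply: le_trans eC _; rewrite ler_pM2l.
have F_ge p q l : slit_domain a p -> slit_domain a q ->
    (l%:E <= path_inf (slit_domain a) p q)%E -> c * l <= ell2_dist (F p) (F q).
  move=> Sp Sq; have [e <- /andP[ce _]] := FE _ _ Sp Sq; rewrite lee_fin => el.
  by apply: le_trans ce; rewrite ler_pM2l.
have c0C : 0 < c <= C by rewrite c0.
have bound := @steep_bound _ _ a_itv _ _ _ c0C F_le F_ge.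
pose theta := c ^+ 2 / (32 * C); pose eta := theta / (16 * C).
have theta0 : 0 < theta by rewrite divr_gt0 ?exprn_gt0// mulr_gt0.
have eta0 : 0 < eta by rewrite divr_gt0// mulr_gt0.
have q0 : 0 < eps / 2 by rewrite divr_gt0.
(* The constants are those of [steep_bound], used with d = a_N, which monotonicity makes a lower
   bound for a_1, ..., a_N; q = eps / 2 leaves room below eps. *)
have [||N k N0|B B0 aB] :=
    @scale_count_bound R (eps / 2) (C / (theta / 2)) (eta / 8) a q0 _ _ a_itv.
- by rewrite divr_gt0.
- by rewrite divr_gt0// divr_gt0.
- rewrite mulrAC => Nk; rewrite ler_pdivlMr; last by rewrite divr_gt0.
  rewrite -mulrA [a N * _]mulrC.
  apply: bound Nk; first exact: a_itv N0.
  by move=> n /andP[n0 nN]; exact: a_noninc.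
- apply: (summable_powR _ B0 a_itv a_noninc aB).
  by rewrite q0 ltr_pdivrMr// ltr_pMr// ltr1n.
Qed.
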